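(* Let $d\in\mathbb N$, $d\ge1$, and let $f\in\mathcal G(\mathbb R^{d+1})$ satisfy $f\circ g=f$ in $\mathcal G(\mathbb R^{d+1})$ for all $g\in SO^+(1,d,\mathbb R)$. Then $f\circ g=f$ in $\mathcal G(\mathbb R^{d+1})$ for all $g\in SO^+(1,d,\widetilde{\mathbb R}_c)$.
   Context: The special Colombeau algebra on $\mathbb R^m$: let $\mathcal E(\mathbb R^m)$ be the algebra of all nets $(u_\varepsilon)_{\varepsilon\in(0,1)}$ of $\mathcal C^\infty$-functions $\mathbb R^m\to\mathbb C$. Let $\mathcal E_M(\mathbb R^m)$ be the set of $(u_\varepsilon)_\varepsilon\in\mathcal E(\mathbb R^m)$ such that for every compact $K\subset\mathbb R^m$ and every multi-index $\alpha\in\mathbb N^m$ there exists $b\in\mathbb R$ with $\sup_{x\in K}|\partial^\alpha u_\varepsilon(x)|=O(\varepsilon^b)$ as $\varepsilon\to0$. Let $\mathcal N(\mathbb R^m)$ be the set of those $(u_\varepsilon)_\varepsilon\in\mathcal E(\mathbb R^m)$ such that for every compact $K$, every $\alpha\in\mathbb N^m$ and every $b\in\mathbb R$, $\sup_{x\in K}|\partial^\alpha u_\varepsilon(x)|=O(\varepsilon^b)$ as $\varepsilon\to0$. Then $\mathcal G(\mathbb R^m)=\mathcal E_M(\mathbb R^m)/\mathcal N(\mathbb R^m)$. The ring $\widetilde{\mathbb R}_c$ of Colombeau generalized real numbers with bounded representative consists of the nets $(x_\varepsilon)_{\varepsilon\in(0,1)}$ of real numbers that are bounded for small $\varepsilon$,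 modulo the nets satisfying $|x_\varepsilon|=O(\varepsilon^b)$ as $\varepsilon\to0$ for every $b\in\mathbb R$. $\mathbb R$ is embedded in $\widetilde{\mathbb R}_c$ by constant nets. $SO^+(1,d,\mathbb R)$ is the group of proper orthochronous Lorentz transformations: the linear transformations of $\mathbb R^{d+1}$, with matrix $A=(a_{ij})_{0\le i,j\le d}$, that preserve the form $t^2-|x|^2$, $(t,x)\in\mathbb R\times\mathbb R^{d}$, and satisfy $\det A=1$ and $a_{00}>0$. $SO^+(1,d,\widetilde{\mathbb R}_c)$ is the group of (generalized) Lorentz transformations with coefficients in $\widetilde{\mathbb R}_c$: the $(d+1)\times(d+1)$ matrices $A=(a_{ij})$ over $\widetilde{\mathbb R}_c$ with $A^tJA=J$, where $J=\mathrm{diag}(1,-1,\dots,-1)$, $\det A=1$ and $a_{00}>0$ (i.e. $a_{00}$ has a representative that is positive for all sufficiently small $\varepsilon$). For a matrix $A$ over $\widetilde{\mathbb R}_c$ with (bounded) representative $(A_\varepsilon)_\varepsilon$, $f\circ A$ is the class of $(f_\varepsilon\circ A_\varepsilon)_\varepsilon$, where $(f_\varepsilon)_\varepsilon$ is a representative of $f$; this is well-defined. *)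

(* Defs.v *)
From HB Require Import structures.
From mathcomp Require Import all_boot all_order all_algebra.
From mathcomp Require Import complex.
From mathcomp Require Import all_classical all_reals all_analysis.

Set Implicit Arguments.
Unset Strict Implicit.
Unset Printing Implicit Defensive.

Import Order.TTheory GRing.Theory Num.Theory.
Import numFieldNormedType.Exports.
Import complex.ComplexField.Normc.

Local Open Scope classical_set_scope.
Local Open Scope ring_scope.
Local Open Scope quotient_scope.

Section Index.
Variable R : realType.

Definition eps_index := {e : R | 0 < e < 1}.

HB.instance Definition _ := Choice.on eps_index.

Lemma eps_index_half : 0 < (2^-1 : R) < 1.
Proof. by rewrite invr_gt0 ltr0n invf_lt1 ?ltr1n ?ltr0n. Qed.

HB.instance Definition _ :=
  isPointed.Build eps_index (exist _ 2^-1 eps_index_half).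

(* The filter "eps --> 0" on the index set (0, 1). *)
Definition eps0 : set_system eps_index :=
  [set P | \forall e \near 0^'+, forall he : 0 < e < 1, P (exist _ e he)].

#[global] Instance eps0_filter : ProperFilter eps0.
Proof.
split; last split.
- move=> h; have : \forall e \near (0 : R)^'+, False.
    near=> e.
    have he : 0 < e < 1.
      by apply/andP; split; near: e;
        [exact: nbhs_right_gt | exact: nbhs_right_lt].
    have : forall he : 0 < e < 1, set0 (exist _ e he : eps_index) by near: e.
    by move=> /(_ he).
  by move=> /filter_ex [].
- exact: nearW.
- move=> P Q hP hQ; rewrite /eps0 /=; near=> e => he.
  by split; move: he; near: e.
- move=> P Q PQ hP; rewrite /eps0 /=; near=> e => he.
  by apply: PQ; move: he; near: e.
Unshelve. all: by end_near. Qed.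

Canonical eps0_filter_on := FilterType eps0 (@filter_filter _ _ eps0_filter).

Lemma eps0_lt (c : R) : 0 < c -> \forall e \near eps0, sval e < c.
Proof.
move=> c0; have := nbhs_right_lt c0; rewrite /eps0 /=.
by apply: filterS => e ec he.
Qed.

Definition bigO_pow (x : eps_index -> R) (b : R) : Prop :=
  x =O_eps0 (fun e => sval e `^ b).

Lemma bigO_powP (x : eps_index -> R) (b : R) : bigO_pow x b <->
  exists2 k, 0 < k & \forall e \near eps0, `|x e| <= k * sval e `^ b.
Proof.
rewrite /bigO_pow; split.
  move/eqO_exP => [k k0 h]; exists k => //; apply: filterS h => e.
  by rewrite [X in _ * X]ger0_norm ?powR_ge0.
move=> [k k0 h]; apply/eqO_exP; exists k => //; apply: filterS h => e.
by rewrite [X in _ -> _ <= _ * X]ger0_norm ?powR_ge0.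
Qed.

End Index.

Section GeneralizedReals.
Variable R : realType.
Local Notation I := (eps_index R).

(* [bounded_near] along [eps0]: bounded for all sufficiently small eps. *)
Definition bounded_net : {pred (I -> R)} :=
  fun x => `[< bounded_near x (@eps0 R) >].

Lemma bounded_netP (x : I -> R) : reflect
  (exists M, \forall e \near @eps0 R, `|x e| <= M) (x \in bounded_net).
Proof. by apply: (iffP (asboolP _)) => /ex_bound. Qed.

Lemma cst_bounded_net (a : R) : (cst a : I -> R) \in bounded_net.
Proof. by apply/bounded_netP; exists `|a|; apply: nearW => e. Qed.

Lemma bounded_net_subring : subring_closed bounded_net.
Proof.
split.
- exact: cst_bounded_net.
- move=> x y /bounded_netP[M hM] /bounded_netP[N hN]; apply/bounded_netP.
  exists (M + N); near=> e; apply: le_trans (ler_normB _ _) _.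
  by apply: lerD; near: e.
- move=> x y /bounded_netP[M hM] /bounded_netP[N hN]; apply/bounded_netP.
  exists (M * N); near=> e; rewrite [X in `|X|]/= normrM.
  by apply: ler_pM => //; near: e.
Unshelve. all: by end_near. Qed.

HB.instance Definition _ :=
  GRing.isSubringClosed.Build _ bounded_net bounded_net_subring.

Record bnet := BNet { bnet_fun :> I -> R; bnet_bounded : bnet_fun \in bounded_net }.

HB.instance Definition _ := [isSub for bnet_fun].
HB.instance Definition _ := [Choice of bnet by <:].
HB.instance Definition _ := [SubChoice_isSubComNzRing of bnet by <:].

Definition bnet_negligible : {pred bnet} :=
  fun x => `[< forall b : R, bigO_pow x b >].

Lemma bnet_negligibleP (x : bnet) :
  reflect (forall b : R, bigO_pow x b) (x \in bnet_negligible).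
Proof. exact: asboolP. Qed.

Lemma bnet_negligible_ideal : idealr_closed bnet_negligible.
Proof.
split.
- apply/bnet_negligibleP => b; apply/bigO_powP; exists 1 => //.
  by apply: nearW => e; rewrite normr0 mul1r powR_ge0.
- apply/negP => /bnet_negligibleP/(_ 1)/bigO_powP[k k0 h].
  have : \forall e \near @eps0 R, False.
    near=> e.
    have h1 : `|(1 : bnet) e| <= k * sval e `^ 1 by near: e.
    have h2 : sval e < k^-1 by near: e; apply: eps0_lt; rewrite invr_gt0.
    have /ltW e0 : 0 < sval e by case/andP: (valP e).
    move: h1; rewrite powRr1 // normr1 leNgt => /negP; apply.
    by rewrite -ltr_pdivlMl // mulr1.
  by move=> /filter_ex [].
- move=> a x y /bnet_negligibleP hx /bnet_negligibleP hy.
  apply/bnet_negligibleP => b; apply/bigO_powP.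
  have /bounded_netP[M hM] := bnet_bounded a.
  have /bigO_powP[k k0 hk] := hx b; have /bigO_powP[l l0 hl] := hy b.
  exists (`|M| * k + l).
    by rewrite ltr_wpDl // mulr_ge0 // ltW.
  near=> e; rewrite [X in `|X|]/=; apply: le_trans (ler_normD _ _) _.
  rewrite mulrDl; apply: lerD; last by near: e.
  rewrite normrM -mulrA; apply: ler_pM => //; last by near: e.
  by apply: le_trans (ler_norm M); near: e.
Unshelve. all: by end_near. Qed.

HB.instance Definition _ :=
  isIdealr.Build _ bnet_negligible bnet_negligible_ideal.

Definition greal := {ideal_quot bnet_negligible}.

HB.instance Definition _ := GRing.ComNzRing.on greal.
HB.instance Definition _ := Quotient.on greal.

Definition greal_cst (a : R) : greal := \pi_greal (BNet (cst_bounded_net a)).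

Definition greal_pos (a : greal) : Prop :=
  exists2 x : bnet, \pi_greal x = a & \forall e \near @eps0 R, 0 < x e.

End GeneralizedReals.

Section Smooth.
Variables (R : realType) (m : nat).
Local Notation V := 'cV[R]_m.
Implicit Types (f : V -> R) (u : V -> R[i]).

Definition partial (i : 'I_m) f : V -> R := 'D_(delta_mx i ord0) f.

Definition partials (s : seq 'I_m) f : V -> R := foldr partial f s.

Definition smooth f : Prop := forall s : seq 'I_m,
  continuous (partials s f) /\
  forall (i : 'I_m) (x : V), derivable (partials s f) x (delta_mx i ord0).

(* The multi-index derivative applies [partial i] [alpha i] times for each [i],
   in the order of the coordinates; on smooth functions any order gives the
   same result. *)
Definition multi_seq (alpha : {ffun 'I_m -> nat}) : seq 'I_m :=
  flatten [seq nseq (alpha i) i | i <- enum 'I_m].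

Definition partial_multi (alpha : {ffun 'I_m -> nat}) f : V -> R :=
  partials (multi_seq alpha) f.

(* The library puts no real normed-space structure on R[i], so complex-valued
   functions are differentiated componentwise. *)
Definition csmooth u : Prop :=
  smooth (fun x => complex.Re (u x)) /\ smooth (fun x => complex.Im (u x)).

Definition cpartial_multi (alpha : {ffun 'I_m -> nat}) u : V -> R[i] :=
  fun x => Complex (partial_multi alpha (fun y => complex.Re (u y)) x)
                   (partial_multi alpha (fun y => complex.Im (u y)) x).

(* A genuine supremum when [K] is compact and [u] is smooth, the only case
   used; it is 0 for empty [K]. *)
Definition seminorm (K : set V) (alpha : {ffun 'I_m -> nat}) u : R :=
  sup [set normc (cpartial_multi alpha u x) | x in K].

Lemma partialsB f g : smooth f -> smooth g -> forall s,
  partials s (f - g) = partials s f - partials s g.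
Proof.
move=> hf hg; elim => //= i s ->; apply/funext => x.
by rewrite /partial deriveB //; [apply (hf s) | apply (hg s)].
Qed.

Lemma smoothB f g : smooth f -> smooth g -> smooth (f - g).
Proof.
move=> hf hg s; rewrite partialsB //.
have [cf df] := hf s; have [cg dg] := hg s; split.
  by move=> x; exact: (continuousB (cf x) (cg x)).
by move=> i x; exact: derivableB (df i x) (dg i x).
Qed.

Lemma smooth0 : smooth (cst 0).
Proof.
have h s : partials s (cst 0 : V -> R) = cst 0.
  by elim: s => //= i s ->; apply/funext => x; rewrite /partial derive_cst.
move=> s; rewrite h; split; first by move=> x; exact: cst_continuous.
by move=> i x; exact: derivable_cst.
Qed.

Lemma compl_ReB u v : (fun y => complex.Re ((u - v) y)) =
  (fun y => complex.Re (u y)) - (fun y => complex.Re (v y)).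
Proof. by apply/funext => y; exact: (raddfB (@complex.Re R)). Qed.

Lemma compl_ImB u v : (fun y => complex.Im ((u - v) y)) =
  (fun y => complex.Im (u y)) - (fun y => complex.Im (v y)).
Proof. by apply/funext => y; exact: (raddfB (@complex.Im R)). Qed.

Lemma csmoothB u v : csmooth u -> csmooth v -> csmooth (u - v).
Proof.
move=> [u1 u2] [v1 v2]; rewrite /csmooth compl_ReB compl_ImB.
by split; exact: smoothB.
Qed.

Lemma cpartial_multiB alpha u v : csmooth u -> csmooth v ->
  cpartial_multi alpha (u - v) = cpartial_multi alpha u - cpartial_multi alpha v.
Proof.
move=> [u1 u2] [v1 v2]; apply/funext => x.
by rewrite /cpartial_multi compl_ReB compl_ImB /partial_multi !partialsB.
Qed.

Lemma normc_leD (z : R[i]) : normc z <= `|complex.Re z| + `|complex.Im z|.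
Proof.
case: z => a b /=.
rewrite -[leRHS]ger0_norm ?addr_ge0 // -sqrtr_sqr ler_sqrt ?sqr_ge0 //.
rewrite sqrrD !real_normK ?num_real // lerD2r lerDl.
by rewrite mulrn_wge0 // mulr_ge0.
Qed.

Lemma smooth_bounded f (K : set V) alpha : smooth f -> compact K ->
  exists M, forall x, K x -> `|partial_multi alpha f x| <= M.
Proof.
move=> hf cK; have [cf _] := hf (multi_seq alpha).
have /compact_bounded[M [Mr hM]] :
    compact (partial_multi alpha f @` K).
  by apply: continuous_compact => //; exact: continuous_subspaceT.
exists (M + 1) => x Kx; apply: (hM (M + 1)); first by rewrite ltrDl.
by exists x.
Qed.

Lemma seminorm_ub (K : set V) alpha u x : csmooth u -> compact K -> K x ->
  normc (cpartial_multi alpha u x) <= seminorm K alpha u.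
Proof.
move=> [u1 u2] cK Kx; apply: ub_le_sup; last by exists x.
have [M hM] := smooth_bounded alpha u1 cK.
have [N hN] := smooth_bounded alpha u2 cK.
exists (M + N) => _ [y Ky <-]; apply: le_trans (normc_leD _) _.
by apply: lerD; [exact: hM | exact: hN].
Qed.

Lemma normc_ge0 (z : R[i]) : 0 <= normc z.
Proof. by case: z => a b; exact: sqrtr_ge0. Qed.

Lemma seminorm_ge0 (K : set V) alpha u : 0 <= seminorm K alpha u.
Proof.
rewrite /seminorm; set A := [set _ | _ in _].
have [[[y Ay] hA]|/sup_out -> //] := pselect (has_sup A).
by apply: le_trans (ub_le_sup hA Ay); case: Ay => x _ <-; exact: normc_ge0.
Qed.

Lemma seminormB (K : set V) alpha u v : csmooth u -> csmooth v -> compact K ->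
  seminorm K alpha (u - v) <= seminorm K alpha u + seminorm K alpha v.
Proof.
move=> hu hv cK; have [->|/set0P[x0 Kx0]] := eqVneq K set0.
  by rewrite {1}/seminorm image_set0 sup0 addr_ge0 // seminorm_ge0.
apply: ge_sup; first by exists (normc (cpartial_multi alpha (u - v) x0)), x0.
move=> _ [x Kx <-]; rewrite cpartial_multiB //.
apply: le_trans (le_normcD _ _) _; rewrite normcN.
by apply: lerD; exact: seminorm_ub.
Qed.

Lemma seminorm_cst0 (K : set V) alpha : seminorm K alpha (0 : V -> R[i]) = 0.
Proof.
have h : cpartial_multi alpha (0 : V -> R[i]) = 0.
  have h0 : csmooth (0 : V -> R[i]) by split; exact: smooth0.
  by rewrite -[X in cpartial_multi _ X](subrr 0) cpartial_multiB // subrr.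
apply/eqP; rewrite eq_le seminorm_ge0 andbT.
have [->|/set0P[x0 Kx0]] := eqVneq K set0.
  by rewrite /seminorm image_set0 sup0.
apply: ge_sup; first by exists (normc (cpartial_multi alpha 0 x0)), x0.
by move=> _ [x Kx <-]; rewrite h [X in X <= _](@normc0 R).
Qed.

End Smooth.

Section Colombeau.
Variables (R : realType) (m : nat).
Local Notation I := (eps_index R).
Local Notation V := 'cV[R]_m.

Definition net := I -> V -> R[i].

HB.instance Definition _ := GRing.Zmodule.on net.

Definition moderate (u : net) : Prop :=
  (forall e, csmooth (u e)) /\
  forall (K : set V) (alpha : {ffun 'I_m -> nat}), compact K ->
    exists b : R, bigO_pow (fun e => seminorm K alpha (u e)) b.

Definition negligible : {pred net} := fun u => `[<
  (forall e, csmooth (u e)) /\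
  forall (K : set V) (alpha : {ffun 'I_m -> nat}), compact K ->
    forall b : R, bigO_pow (fun e => seminorm K alpha (u e)) b >].

Lemma negligible_zmod : zmod_closed negligible.
Proof.
split.
  apply/asboolP; split; first by move=> e; split; exact: smooth0.
  move=> K alpha _ b; apply/bigO_powP; exists 1 => //; apply: nearW => e.
  by rewrite seminorm_cst0 normr0 mul1r powR_ge0.
move=> u v /asboolP[su hu] /asboolP[sv hv]; apply/asboolP; split.
  by move=> e; exact: csmoothB.
move=> K alpha cK b; apply/bigO_powP.
have /bigO_powP[k k0 hk] := hu K alpha cK b.
have /bigO_powP[l l0 hl] := hv K alpha cK b.
exists (k + l); first exact: addr_gt0.
near=> e; rewrite ger0_norm ?seminorm_ge0 //.
apply: le_trans (seminormB _ (su e) (sv e) cK) _; rewrite mulrDl.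
by apply: lerD; apply: le_trans (ler_norm _) _; near: e.
Unshelve. all: by end_near. Qed.

HB.instance Definition _ :=
  GRing.isZmodClosed.Build net negligible negligible_zmod.

(* N is an additive subgroup of all nets of functions, and E_M contains N, so
   the quotient E_M / N is the set of classes of moderate nets. *)
Definition net_quot := {ideal_quot negligible}.

HB.instance Definition _ := GRing.Zmodule.on net_quot.
HB.instance Definition _ := Quotient.on net_quot.

Definition colombeau : set net_quot := [set \pi_net_quot u | u in moderate].

(* [repr] picks a representative of the class. For [f] in [colombeau] the class
   obtained does not depend on the representatives of [f] and [A]. *)
Definition greal_mx_eps (A : 'M[greal R]_m) (e : I) : 'M[R]_m :=
  \matrix_(i, j) (repr (A i j) : bnet R) e.

Definition colombeau_comp (f : net_quot) (A : 'M[greal R]_m) : net_quot :=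
  \pi_net_quot (fun e x => repr f e (greal_mx_eps A e *m x)).

End Colombeau.

Definition minkowski (R : realType) (d : nat) (v : 'cV[R]_d.+1) : R :=
  v ord0 ord0 ^+ 2 - \sum_(i < d) v (lift ord0 i) ord0 ^+ 2.

Definition lorentz (R : realType) (d : nat) (A : 'M[R]_d.+1) : Prop :=
  [/\ forall v, minkowski (A *m v) = minkowski v,
      \det A = 1 & 0 < A ord0 ord0].

Definition lorentz_J (S : comNzRingType) (d : nat) : 'M[S]_d.+1 :=
  diag_mx (\row_i if i == ord0 then 1 else -1).

Definition greal_lorentz (R : realType) (d : nat) (A : 'M[greal R]_d.+1) : Prop :=
  [/\ A^T *m lorentz_J _ d *m A = lorentz_J _ d,
      \det A = 1 & greal_pos (A ord0 ord0)].

Arguments colombeau : clear implicits.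

(* Main.v *)
Require Import Defs.
From HB Require Import structures.
From mathcomp Require Import all_boot all_order all_algebra.
From mathcomp Require Import complex ring lra.
From mathcomp Require Import all_classical all_reals all_analysis.

(** The heart of the matter is uniformity. Let u be a representative of f, or
    rather its real or imaginary part. Invariance under a single Lorentz matrix
    g says that u_e (g x) - u_e x is smaller than any power of e, for e below a
    threshold that depends on g. A generalized matrix is a net of matrices that
    varies with e, so the threshold has to be made uniform in g.

    On a small ball of the Lie algebra the Cayley transform parametrizes Lorentz
    matrices. The sets of parameters for which a given threshold works are
    closed, for fixed exponent and radius, and they exhaust the ball, so by the
    Baire category theorem one of them has an interior point
    ([locally_uniform_invariance]). This gives uniformity near one Lorentz
    matrix g0. It is carried to any other Lorentz matrix g by composing with the
    single matrix g0 g^-1, under which f is invariant. Representatives of a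
    generalized Lorentz matrix form a bounded net, so along an ultrafilter on
    which a hypothetical failure occurs they converge to such a g; this reduces
    the bounded net to the local statement ([generalized_invariance]).

    The representatives A_e are not Lorentz matrices: they satisfy the defining
    equations up to a negligible error. Near g0, projecting the Cayley transform
    of A_e to the Lie algebra and transforming back yields an exact Lorentz
    matrix at negligible distance from A_e ([cayley_retraction]), and a moderate
    net takes negligibly close values at negligibly close points
    ([smooth_net_substitution]).

    All this concerns values of u. Derivatives follow by interpolation: for a
    moderate net, negligible values imply negligible derivatives
    ([negl_on_partials]). That u_e o A_e - u_e is moderate follows from the
    chain rule ([partials_comp_linear]) and the symmetry of partial derivatives
    ([partials_perm]). *)

Set Implicit Arguments.
Unset Strict Implicit.
Unset Printing Implicit Defensive.

Import Order.TTheory GRing.Theory Num.Theory.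
Import numFieldNormedType.Exports.

Local Open Scope classical_set_scope.
Local Open Scope ring_scope.

(** * Norms and limits of matrices *)

Section MatrixAnalysis.
Variable R : realType.

Lemma mx_entry_le_norm m n (M : 'M[R]_(m, n)) i j : `|M i j| <= `|M|.
Proof.
rewrite [leRHS]/Num.norm /= mx_normrE.
exact: (le_bigmax _ (fun ij : 'I_m * 'I_n => `|M ij.1 ij.2|) (i, j)).
Qed.

Lemma mx_norm_le m n (M : 'M[R]_(m, n)) c : 0 <= c ->
  (forall i j, `|M i j| <= c) -> `|M| <= c.
Proof.
move=> c0 hM; rewrite [leLHS]/Num.norm /= mx_normrE.
by apply/bigmax_leP; split => // ij _.
Qed.

Lemma mx_norm_mulmx m n p (A : 'M[R]_(m, n)) (B : 'M[R]_(n, p)) :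
  `|A *m B| <= n%:R * (`|A| * `|B|).
Proof.
apply: mx_norm_le => [|i k]; first by rewrite !mulr_ge0.
rewrite mxE; apply: le_trans (ler_norm_sum _ _ _) _.
have -> : n%:R * (`|A| * `|B|) = \sum_(j < n) `|A| * `|B|.
  by rewrite sumr_const card_ord mulr_natl.
by apply: ler_sum => j _; rewrite normrM ler_pM // mx_entry_le_norm.
Qed.

Section Limits.
Variables (T : Type) (F : set_system T).
Context {FF : Filter F}.

(** Entrywise limits suffice because the norm is the maximum of finitely many
    entries. *)
Lemma cvg_mx m n (M : T -> 'M[R]_(m, n)) (L : 'M[R]_(m, n)) :
  (forall i j, M t i j @[t --> F] --> L i j) -> M t @[t --> F] --> L.
Proof.
move=> h; apply/cvgrPdist_le => e e0.
have H : \forall t \near F, forall i j, `|L i j - M t i j| <= e.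
  apply: (@filter_forall T 'I_m
    (fun i t => forall j, `|L i j - M t i j| <= e)) => i.
  apply: (@filter_forall T 'I_n (fun j t => `|L i j - M t i j| <= e)) => j.
  by move/cvgrPdist_le: (h i j) => /(_ e e0).
apply: filterS H => t H; apply: mx_norm_le => [|i j]; first exact: ltW.
by rewrite !mxE.
Qed.

Lemma cvg_mx_entry m n (M : T -> 'M[R]_(m, n)) (L : 'M[R]_(m, n)) i j :
  M t @[t --> F] --> L -> M t i j @[t --> F] --> L i j.
Proof.
move=> h; have C : {for L, continuous (fun N : 'M[R]_(m, n) => N i j)}.
  exact: coord_continuous.
apply: (@cvg_comp T _ _ M (fun N : 'M[R]_(m, n) => N i j) F (nbhs L)
  (nbhs (L i j))); first exact: h.
exact: C.
Qed.

Lemma cvg_trmx m n (M : T -> 'M[R]_(m, n)) (L : 'M[R]_(m, n)) :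
  M t @[t --> F] --> L -> (M t)^T @[t --> F] --> L^T.
Proof.
move=> h; apply: cvg_mx => i j; under eq_fun do rewrite mxE.
by rewrite mxE; exact: cvg_mx_entry.
Qed.

Lemma cvg_sumr (I : Type) (r : seq I) (P : pred I) (f : I -> T -> R) (l : I -> R) :
  (forall i, P i -> f i t @[t --> F] --> l i) ->
  (\sum_(i <- r | P i) f i t) @[t --> F] --> \sum_(i <- r | P i) l i.
Proof. by apply: cvg_big; exact: add_continuous. Qed.

Lemma cvg_prodr (I : Type) (r : seq I) (P : pred I) (f : I -> T -> R) (l : I -> R) :
  (forall i, P i -> f i t @[t --> F] --> l i) ->
  (\prod_(i <- r | P i) f i t) @[t --> F] --> \prod_(i <- r | P i) l i.
Proof. by apply: cvg_big; exact: mul_continuous. Qed.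

Lemma cvg_mulmx m n p (A : T -> 'M[R]_(m, n)) (B : T -> 'M[R]_(n, p))
    (LA : 'M[R]_(m, n)) (LB : 'M[R]_(n, p)) :
  A t @[t --> F] --> LA -> B t @[t --> F] --> LB ->
  A t *m B t @[t --> F] --> LA *m LB.
Proof.
move=> hA hB; apply: cvg_mx => i j; under eq_fun do rewrite mxE.
rewrite mxE; apply: cvg_sumr => k _.
by apply: cvgM; exact: cvg_mx_entry.
Qed.

Lemma cvg_det n (A : T -> 'M[R]_n) (LA : 'M[R]_n) :
  A t @[t --> F] --> LA -> \det (A t) @[t --> F] --> \det LA.
Proof.
move=> hA; apply: cvg_sumr => s _; apply: cvgM; first exact: cvg_cst.
by apply: cvg_prodr => i _; exact: cvg_mx_entry.
Qed.

(** Cramer's rule writes the inverse as a quotient of polynomials in the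
    entries, the denominator being a determinant that does not vanish. *)
Lemma cvg_invmx n (A : T -> 'M[R]_n) (LA : 'M[R]_n) : LA \in unitmx ->
  (\forall t \near F, A t \in unitmx) ->
  A t @[t --> F] --> LA -> invmx (A t) @[t --> F] --> invmx LA.
Proof.
move=> uL uA hA.
have C : (\det (A t))^-1 *: \adj (A t) @[t --> F] --> (\det LA)^-1 *: \adj LA.
  apply: cvgZ.
    apply: cvgV; last exact: cvg_det.
    by move: uL; rewrite unitmxE unitfE.
  apply: cvg_mx => i j; under eq_fun do rewrite mxE.
  rewrite mxE; apply: cvgM; first exact: cvg_cst.
  apply: cvg_det; apply: cvg_mx => k l; under eq_fun do rewrite !mxE.
  by rewrite !mxE; exact: cvg_mx_entry.
have -> : invmx LA = (\det LA)^-1 *: \adj LA by rewrite /invmx uL.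
apply: cvg_trans C; apply: near_eq_cvg.
by apply: filterS uA => t ut; rewrite /invmx ut.
Qed.

Lemma near_unitmx n (A : T -> 'M[R]_n) (LA : 'M[R]_n) : LA \in unitmx ->
  A t @[t --> F] --> LA -> \forall t \near F, A t \in unitmx.
Proof.
rewrite unitmxE unitfE => uL /cvg_det hA.
by apply: filterS (cvgr_neq0 _ hA uL) => t; rewrite unitmxE unitfE.
Qed.

End Limits.

Lemma mulmx_continuous m n p (A : 'M[R]_(m, n)) :
  continuous (mulmx A : 'M[R]_(n, p) -> _).
Proof.
move=> x; apply: (@cvg_mulmx _ (nbhs x) _ m n p (fun=> A) id) => //.
exact: cvg_cst.
Qed.

End MatrixAnalysis.

(** * Directional derivatives *)

Section DirectionalDerivative.
Variables (R : realType) (V : normedModType R).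
Implicit Types (f : V -> R) (x a b v : V).

(** Turns directional derivatives into derivatives of functions of one real
    variable, to which the classical mean value theorem applies. *)
Lemma is_derive_line f x v (t : R) : derivable f (x + t *: v) v ->
  is_derive t 1 (fun s : R => f (x + s *: v)) ('D_v f (x + t *: v)).
Proof.
move=> df.
have E : (fun h : R => h^-1 *: (((fun s => f (x + s *: v)) \o shift t) (h *: 1)
           - f (x + t *: v))) =
         (fun h : R => h^-1 *: ((f \o shift (x + t *: v)) (h *: v)
           - f (x + t *: v))).
  apply/funext => h /=; congr (_ *: (f _ - _)).
  by rewrite [h *: 1]mulr1 scalerDl addrCA addrC.
by apply: DeriveDef; rewrite /derivable /derive E.
Qed.

Lemma directional_MVT f v : (forall y, derivable f y v) -> forall x (h : R),
  exists2 s, `|s| <= `|h| & f (x + h *: v) - f x = h * 'D_v f (x + s *: v).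
Proof.
move=> df x h; pose g (t : R) := f (x + t *: v).
have dg (t : R) : is_derive t 1 g ('D_v f (x + t *: v)) by exact: is_derive_line.
have cg (i : interval R) : {within [set` i], continuous g}.
  by apply: derivable_within_continuous => t _; case: (dg t).
have g0 : g 0 = f x by rewrite /g scale0r addr0.
have [h0|h0] := leP 0 h.
  have [c /[!in_itv]/= /andP[c0 ch]] := MVT_segment h0 (fun t _ => dg t) (cg _).
  rewrite g0 subr0 mulrC => E; exists c => //.
  by rewrite !ger0_norm.
have [c /[!in_itv]/= /andP[c0 ch]] :=
  MVT_segment (ltW h0) (fun t _ => dg t) (cg _).
rewrite g0 sub0r mulrC mulNr => E; exists c.
  by rewrite ler0_norm // ltr0_norm // lerN2.
by rewrite -[LHS]opprB E opprK.
Qed.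

(** Smoothness is phrased with partial derivatives only; this is the step from
    continuous partial derivatives to derivatives in all directions. The
    increment along a + b is an increment along a, plus one along b that the
    mean value theorem evaluates at a nearby point, where continuity of the
    derivative along b gives the limit. *)
Lemma is_deriveD_direction f x a b :
  derivable f x a -> (forall y, derivable f y b) ->
  {for x, continuous ('D_b f)} ->
  is_derive x (a + b) f ('D_a f x + 'D_b f x).
Proof.
move=> da db cb.
have /choice[s hs] : forall h : R, exists s : R, `|s| <= `|h| /\
    f ((h *: a + x) + h *: b) - f (h *: a + x) =
    h * 'D_b f (h *: a + x + s *: b).
  move=> h; have [s] := directional_MVT db (h *: a + x) h.
  by exists s.
have s0 : s h @[h --> 0^'] --> (0 : R).
  apply/cvgr0Pnorm_lt => e e0; near=> h.
  apply: le_lt_trans (hs h).1 _.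
  near: h; apply: dnbhs0_lt; exact: e0.
have h0 : h @[h --> (0 : R)^'] --> (0 : R) by exact: nbhs_dnbhs.
have cbh : 'D_b f (h *: a + x + s h *: b) @[h --> 0^'] --> 'D_b f x.
  have T : (h *: a + x + s h *: b) @[h --> 0^'] --> 0 *: a + x + 0 *: b.
    by apply: cvgD; [apply: cvgD; [apply: cvgZl|exact: cvg_cst]|apply: cvgZl].
  rewrite !scale0r add0r addr0 in T.
  exact: cvg_comp T cb.
suff C : h^-1 *: ((f \o shift x) (h *: (a + b)) - f x) @[h --> 0^'] -->
    'D_a f x + 'D_b f x.
  by apply: DeriveDef; [apply/cvg_ex; eexists; exact: C|exact: cvg_lim C].
have : h^-1 *: ((f \o shift x) (h *: a) - f x) + 'D_b f (h *: a + x + s h *: b)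
   @[h --> 0^'] --> 'D_a f x + 'D_b f x by apply: cvgD => //; exact: da.
apply: cvg_trans; apply: near_eq_cvg; near=> h.
have hn0 : h != 0 by near: h; exact: nbhs_dnbhs_neq.
have [_ E] := hs h; rewrite /= [h *: (a + b)]scalerDr.
have -> : h *: a + h *: b + x = h *: a + x + h *: b by rewrite addrAC.
have -> : 'D_b f (h *: a + x + s h *: b) =
    h^-1 * (f (h *: a + x + h *: b) - f (h *: a + x)) by rewrite E mulKf.
rewrite -[LHS]/(h^-1 * _ + _) -[RHS]/(h^-1 * _) -mulrDr; congr (_ * _).
by rewrite addrC subrKA.
Unshelve. all: by end_near. Qed.

Lemma is_deriveZ_direction f x v (c : R) : derivable f x v ->
  is_derive x (c *: v) f (c * 'D_v f x).
Proof.
move=> dv; have [->|c0] := eqVneq c 0.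
  by rewrite scale0r mul0r; exact: is_derive0.
have ch : (c * h) @[h --> (0 : R)^'] --> (0 : R)^'.
  move=> P; rewrite /dnbhs /within /= => -[e /= e0 he].
  exists (e / `|c|); first by rewrite /= divr_gt0 ?normr_gt0.
  move=> h /=; rewrite sub0r normrN => hh h0; apply: he.
    by rewrite /= sub0r normrN normrM -ltr_pdivlMl ?normr_gt0 // mulrC.
  by rewrite mulf_neq0.
have /cvg_comp /(_ dv) C := ch.
have {}C : h^-1 *: ((f \o shift x) (h *: (c *: v)) - f x) @[h --> 0^'] -->
    c * 'D_v f x.
  have : c * ((c * h)^-1 *: ((f \o shift x) ((c * h) *: v) - f x))
     @[h --> 0^'] --> c * 'D_v f x by apply: cvgM; [exact: cvg_cst|exact: C].
  apply: cvg_trans; apply: near_eq_cvg; near=> h.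
  have hn0 : h != 0 by near: h; exact: nbhs_dnbhs_neq.
  rewrite scalerA [h * c]mulrC; set D := (X in _ *: X).
  by change (c * ((c * h)^-1 * D) = h^-1 * D); rewrite invfM !mulrA mulfV // mul1r.
by apply: DeriveDef; [apply/cvg_ex; eexists; exact: C|exact: cvg_lim C].
Unshelve. all: by end_near. Qed.

End DirectionalDerivative.

Section Schwarz.
Variables (R : realType) (V : normedModType R).
Implicit Types (f : V -> R) (x a b c v : V).

Lemma is_derive_translate f c x v : derivable f (x + c) v ->
  is_derive x v (fun y => f (y + c)) ('D_v f (x + c)).
Proof.
move=> df.
have E : (fun h : R => h^-1 *: (((fun y => f (y + c)) \o shift x) (h *: v)
           - f (x + c))) =
         (fun h : R => h^-1 *: ((f \o shift (x + c)) (h *: v) - f (x + c))).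
  by apply/funext => h /=; rewrite addrA.
by apply: DeriveDef; rewrite /derivable /derive E.
Qed.

(** Two applications of the mean value theorem, first along a, then along b. *)
Lemma second_difference f a b : (forall y, derivable f y a) ->
  (forall y, derivable ('D_a f) y b) -> forall x (h : R),
  exists s : R * R, [/\ `|s.1| <= `|h|, `|s.2| <= `|h| &
    f (x + h *: a + h *: b) - f (x + h *: a) - (f (x + h *: b) - f x)
    = h ^+ 2 * 'D_b ('D_a f) (x + s.1 *: a + s.2 *: b)].
Proof.
move=> da dba x h; pose g y := f (y + h *: b) - f y.
have dg y : is_derive y a g ('D_a f (y + h *: b) - 'D_a f y).
  by apply: is_deriveB; [exact: is_derive_translate|exact: derivableP].
have [|s hs] := @directional_MVT R V g a _ x h; first by move=> y; case: (dg y).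
rewrite {1 2}/g => ->; rewrite derive_val.
have [s' hs' ->] := directional_MVT dba (x + s *: a) h.
by exists (s, s'); rewrite mulrA.
Qed.

(** Schwarz's theorem: the second difference of f along h a and h b is symmetric
    in a and b, and divided by h ^ 2 it is a value, at a point close to x, of
    either of the two mixed derivatives. *)
Lemma derive_swap f a b x :
  (forall y, derivable f y a) -> (forall y, derivable f y b) ->
  (forall y, derivable ('D_a f) y b) -> (forall y, derivable ('D_b f) y a) ->
  {for x, continuous ('D_b ('D_a f))} -> {for x, continuous ('D_a ('D_b f))} ->
  'D_a ('D_b f) x = 'D_b ('D_a f) x.
Proof.
move=> da db dba dab cba cab.
have /choice[s hs] := second_difference da dba x.
have /choice[t ht] := second_difference db dab x.
have small (k : R -> R) : (forall h, `|k h| <= `|h|) ->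
    k h @[h --> (0 : R)^'] --> (0 : R).
  move=> hk; apply/cvgr0Pnorm_lt => e e0; near=> h.
  apply: le_lt_trans (hk h) _; near: h; exact: dnbhs0_lt.
have toward (p : R -> R * R) (u v : V) : (forall h, `|(p h).1| <= `|h|) ->
    (forall h, `|(p h).2| <= `|h|) ->
    x + (p h).1 *: u + (p h).2 *: v @[h --> (0 : R)^'] --> x.
  move=> p1 p2.
  have : x + (p h).1 *: u + (p h).2 *: v @[h --> (0 : R)^'] -->
         x + 0 *: u + 0 *: v.
    apply: cvgD; last by apply: cvgZl; exact: (small (fun h => (p h).2)).
    apply: cvgD; first exact: cvg_cst.
    by apply: cvgZl; exact: (small (fun h => (p h).1)).
  by rewrite !scale0r !addr0.
have Cba : 'D_b ('D_a f) (x + (s h).1 *: a + (s h).2 *: b) @[h --> (0 : R)^']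
    --> 'D_b ('D_a f) x.
  have T := toward s a b (fun h => let: And3 H _ _ := hs h in H)
    (fun h => let: And3 _ H _ := hs h in H).
  exact: cvg_comp T cba.
have Cab : 'D_a ('D_b f) (x + (t h).1 *: b + (t h).2 *: a) @[h --> (0 : R)^']
    --> 'D_a ('D_b f) x.
  have T := toward t b a (fun h => let: And3 H _ _ := ht h in H)
    (fun h => let: And3 _ H _ := ht h in H).
  exact: cvg_comp T cab.
apply: (@cvg_unique _ (@norm_hausdorff R R) _ _ _ _ Cab); last first.
apply: cvg_trans Cba; apply: near_eq_cvg; near=> h.
have hn0 : h ^+ 2 != 0 by rewrite expf_neq0 //; near: h; exact: nbhs_dnbhs_neq.
have [_ _ E] := hs h; have [_ _ F] := ht h.
apply: (mulfI hn0); rewrite -E -F.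
by rewrite [x + h *: b + h *: a]addrAC; ring.
Unshelve. all: by end_near. Qed.

End Schwarz.

(** * Partial derivatives of smooth functions *)

Section SmoothFunctions.
Variables (R : realType) (m : nat).
Local Notation V := 'cV[R]_m.
Implicit Types (f : V -> R) (x v : V) (s : seq 'I_m).
Local Notation basis i := (delta_mx i ord0 : V).

Lemma smooth_partials f s : smooth f -> smooth (partials s f).
Proof. by move=> hf t; rewrite /partials -foldr_cat; exact: hf. Qed.

Lemma smooth_continuous f : smooth f -> continuous f.
Proof. by move=> hf; have [] := hf [::]. Qed.

Lemma smooth_is_derive f x v : smooth f ->
  is_derive x v f (\sum_i v i ord0 * partial i f x).
Proof.
move=> hf; have dp i y : derivable f y (basis i) by have [_] := hf [::]; apply.
have dpZ i (c : R) y : is_derive y (c *: (basis i)) f (c * partial i f y).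
  exact: is_deriveZ_direction.
have -> : v = \sum_i v i ord0 *: (basis i).
  by rewrite [LHS]matrix_sum_delta; apply: eq_bigr => i _; rewrite big_ord1.
suff H (l : seq 'I_m) y : is_derive y (\sum_(i <- l) v i ord0 *: (basis i)) f
    (\sum_(i <- l) v i ord0 * partial i f y).
  have := H (index_enum 'I_m) x; congr is_derive.
  apply: eq_bigr => i _; congr (_ * _).
  rewrite summxE (bigD1 i) //= big1 ?addr0 => [|j ji]; rewrite !mxE !eqxx ?mulr1 //.
  by rewrite eq_sym (negPf ji) mulr0.
elim: l y => [|i l IH] y; first by rewrite !big_nil; exact: is_derive0.
rewrite !big_cons ![_ + \sum_(_ <- _) _]addrC.
have E : 'D_(v i ord0 *: (basis i)) f = fun y => v i ord0 * partial i f y.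
  by apply/funext => z; exact: derive_val.
have H : is_derive y (\sum_(j <- l) v j ord0 *: basis j + v i ord0 *: basis i) f
    ('D_(\sum_(j <- l) v j ord0 *: basis j) f y + 'D_(v i ord0 *: basis i) f y).
  apply: is_deriveD_direction.
  - by case: (IH y).
  - by move=> z; case: (dpZ i (v i ord0) z).
  - rewrite E; apply: (@continuousM _ _ (cst (v i ord0)) (partial i f)).
      exact: cst_continuous.
    by have [+ _] := hf [:: i]; apply.
apply: is_derive_eq H _.
have D1 := @derive_val _ _ _ _ _ _ _ (IH y).
have D2 := congr1 (@^~ y) E.
by rewrite D1 -D2.
Qed.

Lemma partialC f i j : smooth f ->
  partial i (partial j f) = partial j (partial i f).
Proof.
move=> hf; apply/funext => x; apply: derive_swap.
- by have [_] := hf [::]; apply.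
- by have [_] := hf [::]; apply.
- by have [_] := hf [:: i]; apply.
- by have [_] := hf [:: j]; apply.
- by have [+ _] := hf [:: j; i]; apply.
- by have [+ _] := hf [:: i; j]; apply.
Qed.

(** Moderateness controls multi-index derivatives, whose order is fixed, whereas
    the chain rule produces the derivatives in every order. *)
Lemma partials_perm f s t : smooth f -> perm_eq s t ->
  partials s f = partials t f.
Proof.
move=> hf; have swap i l (g : V -> R) : smooth g ->
    partial i (partials l g) = partials l (partial i g).
  move=> hg; elim: l => // j l IH.
  change (partial i (partial j (partials l g)) =
          partial j (partials l (partial i g))).
  by rewrite -IH partialC //; exact: smooth_partials.
have swaps l l' (g : V -> R) : smooth g ->
    partials l (partials l' g) = partials l' (partials l g).
  move=> hg; elim: l => // i l IH.
  change (partial i (partials l (partials l' g)) =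
          partials l' (partial i (partials l g))).
  by rewrite IH swap //; exact: smooth_partials.
have H s1 s2 s3 : partials (s1 ++ s2 ++ s3) f = partials (s2 ++ s1 ++ s3) f.
  by rewrite /partials !foldr_cat; apply: swaps; exact: smooth_partials.
exact: (catCA_perm_subst H).
Qed.

End SmoothFunctions.

(** * Linear substitutions *)

Section LinearSubstitution.
Variables (R : realType) (m : nat).
Local Notation V := 'cV[R]_m.
Implicit Types (f : V -> R) (x v : V) (s t : seq 'I_m) (A : 'M[R]_m).
Local Notation basis i := (delta_mx i ord0 : V).

Lemma is_derive_comp_linear f A x v : smooth f ->
  is_derive x v (fun y => f (A *m y)) ('D_(A *m v) f (A *m x)).
Proof.
move=> hf.
have E : (fun h : R => h^-1 *: (((fun y => f (A *m y)) \o shift x) (h *: v)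
           - f (A *m x))) =
  (fun h : R => h^-1 *: ((f \o shift (A *m x)) (h *: (A *m v)) - f (A *m x))).
  by apply/funext => h /=; rewrite mulmxDr scalemxAr.
have D := smooth_is_derive (A *m x) (A *m v) hf.
apply: DeriveDef; rewrite /derivable /derive E //.
by case: D.
Qed.

Fixpoint words n : seq (seq 'I_m) :=
  if n is n'.+1 then [seq j :: t | t <- words n', j <- index_enum 'I_m]
  else [:: [::]].

Definition weight A s t : R := \prod_(p <- zip t s) A p.1 p.2.

Lemma is_derive_linear_combination (l : seq (seq 'I_m)) (c : seq 'I_m -> R)
    f A i x : smooth f ->
  is_derive x (basis i) (fun y => \sum_(t <- l) c t * partials t f (A *m y))
    (\sum_(t <- l) c t * \sum_j A j i * partials (j :: t) f (A *m x)).
Proof.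
move=> hf; elim: l => [|t l IH].
  rewrite big_nil; under eq_fun do rewrite big_nil.
  exact: is_derive_cst.
rewrite big_cons; under eq_fun do rewrite big_cons.
apply: is_deriveD => //; apply: is_deriveZ.
apply: is_derive_eq.
  exact: (is_derive_comp_linear A x (basis i) (smooth_partials t hf)).
have D := smooth_is_derive (A *m x) (A *m basis i) (smooth_partials t hf).
rewrite (@derive_val _ _ _ _ _ _ _ D); apply: eq_bigr => j _; congr (_ * _).
rewrite mxE (bigD1 i) //= big1 => [|k ki]; rewrite !mxE ?eqxx ?mulr1 ?addr0 //.
by rewrite (negPf ki) mulr0.
Qed.

(** The iterated chain rule. Only the weights depend on A, polynomially: a
    bounded net of matrices thus preserves moderate bounds. *)
Lemma partials_comp_linear f A s : smooth f ->
  partials s (fun x => f (A *m x)) =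
  fun x => \sum_(t <- words (size s)) weight A s t * partials t f (A *m x).
Proof.
move=> hf; elim: s => [|i s IH].
  by apply/funext => x; rewrite /= big_seq1 /weight big_nil mul1r.
apply/funext => x.
change (partial i (partials s (fun x => f (A *m x))) x =
 \sum_(t <- words (size s).+1) weight A (i :: s) t * partials t f (A *m x)).
rewrite IH /partial.
have D := is_derive_linear_combination (words (size s)) (weight A s) A i x hf.
rewrite (@derive_val _ _ _ _ _ _ _ D) /= big_allpairs_dep; apply: eq_bigr => t _.
rewrite big_distrr; apply: eq_bigr => j _ /=.
by rewrite /weight /= big_cons /= mulrA [_ * A j i]mulrC.
Qed.

Lemma smooth_comp_linear f A : smooth f -> smooth (fun x => f (A *m x)).
Proof.
move=> hf s; rewrite partials_comp_linear //; split.
  move=> x; apply: (@cvg_sumr _ _ (nbhs x) (nbhs_filter x)) => t _.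
  apply: cvgM; first exact: cvg_cst.
  apply: (@continuous_comp _ _ _ (mulmx A) (partials t f)).
    exact: mulmx_continuous.
  by have [+ _] := hf t; apply.
move=> i x.
by case: (is_derive_linear_combination (words (size s)) (weight A s) A i x hf).
Qed.

End LinearSubstitution.

(** * Growth in powers of epsilon *)

Section Estimates.
Variables (R : realType).
Local Notation I := (eps_index R).
Implicit Types (e : I) (b c : R).

Lemma eps_gt0 e : 0 < sval e. Proof. by case/andP: (valP e). Qed.

Lemma eps_lt1 e : sval e < 1. Proof. by case/andP: (valP e). Qed.

Lemma eps_powD e b c : sval e `^ (b + c) = sval e `^ b * sval e `^ c.
Proof. by rewrite powRD // (gt_eqF (eps_gt0 e)) implybT. Qed.

Lemma eps_pow_le e b c : b <= c -> sval e `^ c <= sval e `^ b.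
Proof.
move=> bc; have h : 0 < sval e <= 1
  by apply/andP; split; [exact: eps_gt0|exact/ltW/eps_lt1].
exact: (ger_powR h).
Qed.

(** Moderate and negligible nets of functions on a set D, uniformly on D. The
    filter is arbitrary, since the final argument works along an ultrafilter
    finer than epsilon tending to 0. *)
Definition mod_on (F : set_system I) T (D : set T) (x : I -> T -> R) : Prop :=
  exists b, \forall e \near F, forall t, D t -> `|x e t| <= sval e `^ b.

Definition negl_on (F : set_system I) T (D : set T) (x : I -> T -> R) : Prop :=
  forall b, \forall e \near F, forall t, D t -> `|x e t| <= sval e `^ b.

Variables (F : set_system I).
Context {FF : Filter F}.
Hypothesis F0 : @eps0 R `<=` F.

Lemma near_eps_lt c : 0 < c -> \forall e \near F, sval e < c.
Proof. by move=> c0; apply: F0; exact: eps0_lt. Qed.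

(** Constants are absorbed by lowering the exponent, which is why no constant
    occurs in [mod_on] and [negl_on]. *)
Lemma near_absorb (k b c : R) : b < c ->
  \forall e \near F, k * sval e `^ c <= sval e `^ b.
Proof.
move=> bc; have cb : 0 < c - b by rewrite subr_gt0.
have k1 : 0 < `|k| + 1 by rewrite ltr_wpDl.
near=> e; have -> : c = (c - b) + b by rewrite subrK.
rewrite eps_powD mulrA ger_pMl ?powR_gt0 ?eps_gt0 //.
have he : sval e <= (`|k| + 1)^-1 `^ (c - b)^-1.
  by apply: ltW; near: e; apply: near_eps_lt; rewrite powR_gt0 ?invr_gt0.
apply: (@le_trans _ _ (`|k| * (`|k| + 1)^-1)); last first.
  by rewrite ler_pdivrMr // mul1r lerDl.
apply: le_trans (ler_wpM2r (powR_ge0 _ _) (ler_norm k)) _.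
apply: ler_wpM2l => //.
have : sval e `^ (c - b) <= ((`|k| + 1)^-1 `^ (c - b)^-1) `^ (c - b).
  by apply: ge0_ler_powR he; rewrite ?nnegrE ?powR_ge0 ?ltW ?eps_gt0.
by rewrite -powRrM mulVf ?gt_eqF // powRr1 // invr_ge0 ltW.
Unshelve. all: by end_near. Qed.

Variables (T : Type) (D : set T).
Implicit Types x y : I -> T -> R.

Lemma mod_on_bounded x k :
  (\forall e \near F, forall t, D t -> `|x e t| <= k) -> mod_on F D x.
Proof.
move=> hk; exists (-1); near=> e => t Dt.
apply: (@le_trans _ _ (k * sval e `^ 0)).
  by rewrite powRr0 mulr1; move: t Dt; near: e.
by near: e; apply: near_absorb; rewrite ltrN10.
Unshelve. all: by end_near. Qed.

Lemma mod_onD x y : mod_on F D x -> mod_on F D y ->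
  mod_on F D (fun e t => x e t + y e t).
Proof.
move=> [b hb] [c hc]; exists (Num.min b c - 1); near=> e => t Dt.
apply: le_trans (ler_normD _ _) _.
apply: (@le_trans _ _ (2 * sval e `^ Num.min b c)).
  rewrite mulr_natl mulr2n lerD //.
    apply: (@le_trans _ _ (sval e `^ b)); first by move: t Dt; near: e.
    by apply: eps_pow_le; rewrite ge_min lexx.
  apply: (@le_trans _ _ (sval e `^ c)); first by move: t Dt; near: e.
  by apply: eps_pow_le; rewrite ge_min lexx orbT.
by near: e; apply: near_absorb; rewrite gtrBl.
Unshelve. all: by end_near. Qed.

Lemma mod_onM x y : mod_on F D x -> mod_on F D y ->
  mod_on F D (fun e t => x e t * y e t).
Proof.
move=> [b hb] [c hc]; exists (b + c); near=> e => t Dt.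
rewrite normrM eps_powD; apply: ler_pM => //.
  by move: t Dt; near: e.
by move: t Dt; near: e.
Unshelve. all: by end_near. Qed.

Lemma negl_onD x y : negl_on F D x -> negl_on F D y ->
  negl_on F D (fun e t => x e t + y e t).
Proof.
move=> hx hy b; near=> e => t Dt.
apply: le_trans (ler_normD _ _) _.
apply: (@le_trans _ _ (2 * sval e `^ (b + 1))).
  rewrite mulr_natl mulr2n lerD //.
    by move: t Dt; near: e; exact: hx.
  by move: t Dt; near: e; exact: hy.
by near: e; apply: near_absorb; rewrite ltrDl.
Unshelve. all: by end_near. Qed.

Lemma negl_onMr x y : negl_on F D x -> mod_on F D y ->
  negl_on F D (fun e t => x e t * y e t).
Proof.
move=> hx [c hc] b; near=> e => t Dt.
have -> : b = (b - c) + c by rewrite subrK.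
rewrite normrM eps_powD; apply: ler_pM => //.
  by move: t Dt; near: e; exact: hx.
by move: t Dt; near: e.
Unshelve. all: by end_near. Qed.

Lemma negl_onMl x y : mod_on F D x -> negl_on F D y ->
  negl_on F D (fun e t => x e t * y e t).
Proof.
by move=> hx hy; under eq_fun do under eq_fun do rewrite mulrC; exact: negl_onMr.
Qed.

Lemma negl_on_near x y : (\forall e \near F, forall t, D t -> x e t = y e t) ->
  negl_on F D x -> negl_on F D y.
Proof.
move=> xy hx b; near=> e => t Dt.
have <- : x e t = y e t by move: t Dt; near: e.
by move: t Dt; near: e; exact: hx.
Unshelve. all: by end_near. Qed.

Lemma mod_on_sum (J : Type) (r : seq J) (x : J -> I -> T -> R) :
  (forall j, mod_on F D (x j)) -> mod_on F D (fun e t => \sum_(j <- r) x j e t).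
Proof.
move=> hx; elim: r => [|j r IH].
  apply: (@mod_on_bounded _ 0); apply: nearW => e t _.
  by rewrite big_nil normr0.
under eq_fun do under eq_fun do rewrite big_cons.
exact: mod_onD.
Qed.

Lemma mod_on_prod (J : Type) (r : seq J) (x : J -> I -> T -> R) :
  (forall j, mod_on F D (x j)) -> mod_on F D (fun e t => \prod_(j <- r) x j e t).
Proof.
move=> hx; elim: r => [|j r IH].
  apply: (@mod_on_bounded _ 1); apply: nearW => e t _.
  by rewrite big_nil normr1.
under eq_fun do under eq_fun do rewrite big_cons.
exact: mod_onM.
Qed.

Lemma negl_on_sum (J : Type) (r : seq J) (x : J -> I -> T -> R) :
  (forall j, negl_on F D (x j)) -> negl_on F D (fun e t => \sum_(j <- r) x j e t).
Proof.
move=> hx; elim: r => [|j r IH].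
  by move=> b; apply: nearW => e t _; rewrite big_nil normr0 powR_ge0.
under eq_fun do under eq_fun do rewrite big_cons.
exact: negl_onD.
Qed.

End Estimates.

(** * Moderate nets of smooth functions *)

Section SmoothNets.
Variables (R : realType) (m : nat).
Local Notation I := (eps_index R).
Local Notation V := 'cV[R]_m.
Local Notation disc r := [set x : V | `|x| <= r].
Implicit Types (u : I -> V -> R) (A B : I -> 'M[R]_m) (r M : R).

Definition negl (F : set_system I) (x : I -> R) : Prop :=
  forall b : R, \forall e \near F, `|x e| <= sval e `^ b.

Definition smooth_moderate u : Prop := (forall e, smooth (u e)) /\
  forall s r, mod_on (@eps0 R) (disc r) (fun e => partials s (u e)).

Lemma negl_on_const (F : set_system I) {FF : Filter F} T (D : set T) (x : I -> R) :
  negl F x -> negl_on F D (fun e _ => x e).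
Proof. by move=> h b; apply: filterS (h b) => e he t _. Qed.

Lemma mod_on_sub (F : set_system I) {FF : Filter F} T (D : set T) (x : I -> T -> R) :
  @eps0 R `<=` F -> mod_on (@eps0 R) D x -> mod_on F D x.
Proof. by move=> F0 [b hb]; exists b; exact: F0. Qed.

Lemma negl_on_le (F : set_system I) {FF : Filter F} T (D : set T) (x y : I -> T -> R) :
  (\forall e \near F, forall t, D t -> `|y e t| <= `|x e t|) ->
  negl_on F D x -> negl_on F D y.
Proof.
move=> xy hx b; near=> e => t Dt.
have h1 : `|y e t| <= `|x e t| by move: t Dt; near: e.
apply: le_trans h1 _; move: t Dt; near: e; exact: hx.
Unshelve. all: by end_near. Qed.

Lemma mulmx_disc (A : 'M[R]_m) (x : V) M r : `|A| <= M -> `|x| <= r ->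
  `|A *m x| <= m%:R * (M * r).
Proof.
move=> hA hx; apply: le_trans (mx_norm_mulmx _ _) _.
by apply: ler_wpM2l => //; exact: ler_pM.
Qed.

Lemma smooth_moderate_partials u s : smooth_moderate u ->
  smooth_moderate (fun e => partials s (u e)).
Proof.
move=> [su hu]; split=> [e|t r]; first exact: smooth_partials.
have -> : (fun e => partials t (partials s (u e))) =
    (fun e => partials (t ++ s) (u e)).
  by apply/funext => e; rewrite /partials foldr_cat.
exact: hu.
Qed.

Lemma smooth_moderate_comp_linear u A M : smooth_moderate u ->
  (\forall e \near @eps0 R, `|A e| <= M) ->
  smooth_moderate (fun e x => u e (A e *m x)).
Proof.
move=> [su hu] hA; split=> [e|s r]; first exact: smooth_comp_linear.
rewrite (_ : (fun e => _) = (fun e x => \sum_(t <- words m (size s))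
    weight (A e) s t * partials t (u e) (A e *m x))); last first.
  by apply/funext => e; exact: partials_comp_linear.
apply: mod_on_sum => // t; apply: mod_onM.
  apply: mod_on_prod => // p; apply: (@mod_on_bounded _ _ _ _ _ _ _ M) => //.
  by apply: filterS hA => e he x _; exact: le_trans (mx_entry_le_norm _ _ _) he.
have [b hb] := hu t (m%:R * (M * r)); exists b; near=> e => x hx.
have h : forall y : V, `|y| <= m%:R * (M * r) ->
    `|partials t (u e) y| <= sval e `^ b by near: e.
by apply: h; apply: mulmx_disc hx; near: e.
Unshelve. all: by end_near. Qed.

(** By the mean value theorem the difference is a value of the differential of
    u, which is moderate on bounded sets, at the vector (A - B) x, which is
    negligible. *)
Lemma smooth_net_substitution (F : set_system I) {FF : Filter F} u A B M r :
  @eps0 R `<=` F -> smooth_moderate u ->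
  (\forall e \near F, `|A e| <= M) -> (\forall e \near F, `|B e| <= M) ->
  negl F (fun e => `|A e - B e|) ->
  negl_on F (disc r) (fun e x => u e (A e *m x) - u e (B e *m x)).
Proof.
move=> F0 [su hu] hA hB hAB.
have /choice[xi hxi] : forall ex : I * V, exists y : V,
    `|y| <= `|B ex.1 *m ex.2| + `|(A ex.1 - B ex.1) *m ex.2| /\
    u ex.1 (A ex.1 *m ex.2) - u ex.1 (B ex.1 *m ex.2) =
    \sum_i ((A ex.1 - B ex.1) *m ex.2) i ord0 * partial i (u ex.1) y.
  move=> [e x] /=; set v := (A e - B e) *m x.
  have dv y : is_derive y v (u e) (\sum_i v i ord0 * partial i (u e) y).
    exact: smooth_is_derive.
  have [|s hs] := @directional_MVT R V (u e) v _ (B e *m x) 1.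
    by move=> y; case: (dv y).
  rewrite scale1r mul1r (@derive_val _ _ _ _ _ _ _ (dv _)).
  have -> : B e *m x + v = A e *m x by rewrite /v -mulmxDl addrC subrK.
  move=> E; exists (B e *m x + s *: v); split => //.
  apply: le_trans (ler_normD _ _) _; rewrite lerD2l normrZ.
  by rewrite ler_piMl // -[leRHS]normr1.
pose v e (x : V) := (A e - B e) *m x.
apply: (@negl_on_near _ _ _ _ _ (fun e x => \sum_i v e x i ord0 *
    partial i (u e) (xi (e, x)))).
  by apply: nearW => e x _; have [_ ->] := hxi (e, x).
apply: negl_on_sum => // i; apply: negl_onMr => //.
  apply: (@negl_on_le _ _ _ _ (fun e x => (m%:R * `|A e - B e|) * `|x|)).
    apply: nearW => e x _; apply: le_trans (mx_entry_le_norm _ _ _) _.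
    apply: le_trans (mx_norm_mulmx _ _) _.
    by rewrite mulrA ger0_norm // !mulr_ge0.
  apply: negl_onMr => //; last first.
    apply: (@mod_on_bounded _ _ _ _ _ _ _ r) => //.
    by apply: nearW => e x; rewrite normr_id.
  apply: negl_onMl => //; last exact: negl_on_const.
  apply: (@mod_on_bounded _ _ _ _ _ _ _ m%:R) => //; apply: nearW => e x _.
  by rewrite normr_nat.
(* The intermediate points xi stay in a disc whose radius does not depend on e. *)
set K := m%:R * (M * r) + m%:R * ((M + M) * r).
have [b hb] := mod_on_sub F0 (hu [:: i] K); exists b; near=> e => x hx.
have h : forall y : V, `|y| <= K -> `|partials [:: i] (u e) y| <= sval e `^ b.
  by near: e.
apply: h; have [h _] := hxi (e, x); apply: le_trans h _.
have hAe : `|A e| <= M by near: e.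
have hBe : `|B e| <= M by near: e.
apply: lerD; apply: mulmx_disc => //.
by apply: le_trans (ler_normB _ _) _; exact: lerD.
Unshelve. all: by end_near. Qed.

(** An interpolation inequality of Landau type. For 0 < h <= 1 the mean value
    theorem gives, with w the i-th basis vector,
    |d_i u (x)| <= (|u (x + h w)| + |u x|) / h + h sup |d_i d_i u|,
    and h is taken to be a power of epsilon, large enough to beat the growth of
    the second derivative; the division by h is harmless because u is smaller
    than any power. *)
Lemma negl_on_partial u i : smooth_moderate u ->
  (forall r, negl_on (@eps0 R) (disc r) u) ->
  forall r, negl_on (@eps0 R) (disc r) (fun e => partial i (u e)).
Proof.
move=> [su hu] nu r b.
have [c hc] := hu [:: i; i] (r + 1 + 1).
(* Chosen so that h * e `^ c <= e `^ (b + 1) and h <= 1, where h = e `^ N. *)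
pose N := `|b| + `|c| + 1.
have hN : b + 1 <= N + c.
  rewrite /N; have := ler_norm b; have := ler_norm (- c); rewrite normrN; lra.
have N0 : 0 <= N by rewrite /N !addr_ge0.
pose w : V := delta_mx i ord0.
have w1 : `|w| <= 1.
  by apply: mx_norm_le => // k l; rewrite mxE; case: andP; rewrite ?normr0 ?normr1.
near=> e => x hx; pose h := sval e `^ N.
have h0 : 0 < h by rewrite powR_gt0 // eps_gt0.
have h1 : h <= 1 by rewrite -(powRr0 (sval e)); exact: eps_pow_le.
have du y : derivable (u e) y w by have [_] := su e [::]; apply.
have du' y : derivable (partial i (u e)) y w by have [_] := su e [:: i]; apply.
have [s hs E] := directional_MVT du x h.
have [s' hs' E'] := directional_MVT du' x s.
have hx1 t : `|t| <= 1 -> `|x + t *: w| <= r + 1.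
  move=> ht; apply: le_trans (ler_normD _ _) _; apply: lerD => //.
  by rewrite normrZ -[leRHS]mul1r ler_pM.
have s1 : `|s| <= 1 by apply: le_trans hs _; rewrite ger0_norm // ltW.
have B1 : `|u e (x + h *: w)| <= sval e `^ (b + 1 + N).
  have H : forall y : V, `|y| <= r + 1 -> `|u e y| <= sval e `^ (b + 1 + N).
    by near: e; exact: nu.
  by apply: H; apply: hx1; rewrite ger0_norm // ltW.
have B0 : `|u e x| <= sval e `^ (b + 1 + N).
  have H : forall y : V, `|y| <= r -> `|u e y| <= sval e `^ (b + 1 + N).
    by near: e; exact: nu.
  exact: H.
have B2 : `|'D_w (partial i (u e)) (x + s' *: w)| <= sval e `^ c.
  have H : forall y : V, `|y| <= r + 1 + 1 ->
      `|partials [:: i; i] (u e) y| <= sval e `^ c by near: e.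
  apply: H; apply: le_trans (hx1 _ (le_trans hs' s1)) _.
  by rewrite lerDl.
have D1 : `|partial i (u e) (x + s *: w)| <= 2 * sval e `^ (b + 1).
  have -> : partial i (u e) (x + s *: w) = h^-1 * (u e (x + h *: w) - u e x).
    by rewrite E mulKf // gt_eqF.
  rewrite normrM gtr0_norm ?invr_gt0 // mulrC ler_pdivrMr //.
  apply: le_trans (ler_normB _ _) _.
  by rewrite -mulrA -eps_powD mulr_natl mulr2n lerD.
have D2 : `|partial i (u e) (x + s *: w) - partial i (u e) x| <= sval e `^ (b + 1).
  rewrite E' normrM; apply: (@le_trans _ _ (h * sval e `^ c)).
    by apply: ler_pM => //; rewrite -[h]gtr0_norm.
  by rewrite /h -eps_powD; exact: eps_pow_le.
have -> : partial i (u e) x = partial i (u e) (x + s *: w) -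
   (partial i (u e) (x + s *: w) - partial i (u e) x) by rewrite subKr.
apply: le_trans (ler_normB _ _) _.
apply: (@le_trans _ _ (3 * sval e `^ (b + 1))).
  by have := lerD D1 D2; lra.
by near: e; apply: near_absorb => //; rewrite ltrDl.
Unshelve. all: by end_near. Qed.

(** Hence, for a moderate net, negligibility of the values is enough. *)
Lemma negl_on_partials u : smooth_moderate u ->
  (forall r, negl_on (@eps0 R) (disc r) u) ->
  forall s r, negl_on (@eps0 R) (disc r) (fun e => partials s (u e)).
Proof.
move=> mu nu; elim=> [|i s IH] r; first exact: nu.
by apply: negl_on_partial => //; exact: smooth_moderate_partials.
Qed.

End SmoothNets.

(** * The Cayley transform for the Minkowski form *)

Section Cayley.
Variables (R : realType) (d : nat).
Local Notation M := 'M[R]_d.+1.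
Implicit Types (A B X Y W : M).
Local Notation J := (lorentz_J R d).

(** The adjoint for the Minkowski form. Isometries are the A whose adjoint is a
    left inverse; the Lie algebra consists of the X whose adjoint is - X. *)
Definition mink_adj A : M := J *m A^T *m J.
Local Notation "A ^*J" := (mink_adj A) (at level 2, format "A ^*J").

Lemma lorentz_J_sqr : J *m J = 1%:M.
Proof.
rewrite /lorentz_J mulmx_diag -diag_const_mx; congr diag_mx.
by apply/rowP => i; rewrite !mxE; case: ifP; rewrite ?mulr1 ?mulrNN ?mulr1.
Qed.

Lemma trmx_lorentz_J : J^T = J.
Proof. exact: tr_diag_mx. Qed.

Lemma mink_adjM A B : (A *m B)^*J = B^*J *m A^*J.
Proof.
rewrite /mink_adj trmx_mul !mulmxA; congr (_ *m _).
by rewrite -[_ *m J *m J]mulmxA lorentz_J_sqr mulmx1.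
Qed.

Lemma mink_adj1 : (1%:M)^*J = 1%:M.
Proof. by rewrite /mink_adj trmx1 mulmx1 lorentz_J_sqr. Qed.

Lemma mink_adjD A B : (A + B)^*J = A^*J + B^*J.
Proof. by rewrite /mink_adj linearD mulmxDr mulmxDl. Qed.

Lemma mink_adjZ (c : R) A : (c *: A)^*J = c *: A^*J.
Proof. by rewrite /mink_adj linearZ /= -scalemxAr -scalemxAl. Qed.

Lemma mink_adjN A : (- A)^*J = - A^*J.
Proof. by rewrite -scaleN1r mink_adjZ scaleN1r. Qed.

Lemma det_mink_adj A : \det A^*J = \det A.
Proof.
have D : \det J * \det J = 1 by rewrite -det_mulmx lorentz_J_sqr det1.
by rewrite /mink_adj !det_mulmx det_tr mulrAC D mul1r.
Qed.

Lemma mink_adj_mul A : A^*J *m A = J *m (A^T *m J *m A).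
Proof. by rewrite /mink_adj !mulmxA. Qed.

Lemma mink_orthogonalP A : A^*J *m A = 1%:M -> A^T *m J *m A = J.
Proof.
rewrite mink_adj_mul => /(congr1 (mulmx J)).
by rewrite mulmxA lorentz_J_sqr mul1mx mulmx1.
Qed.

Lemma minkowskiE (v : 'cV[R]_d.+1) : Defs.minkowski v = (v^T *m J *m v) ord0 ord0.
Proof.
rewrite mxE /lorentz_J mul_mx_diag big_ord_recl !mxE /= mulr1 /Defs.minkowski expr2.
congr (_ + _); rewrite -sumrN; apply: eq_bigr => i _.
by rewrite !mxE /= mulrN1 mulNr expr2.
Qed.

Lemma lorentz_of_isometry A :
  A^T *m J *m A = J -> \det A = 1 -> 0 < A ord0 ord0 -> lorentz A.
Proof.
move=> hA dA A0; split => // v.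
rewrite !minkowskiE trmx_mul !mulmxA -[_ *m A^T *m J]mulmxA.
by rewrite -[_ *m (A^T *m J) *m A]mulmxA hA.
Qed.

(** A rational involution that exchanges isometries and elements of the Lie
    algebra, where defined. *)
Definition cayley X : M := (1%:M - X) *m invmx (1%:M + X).

Lemma cayleyE X : 1%:M + X \in unitmx ->
  cayley X = 2 *: invmx (1%:M + X) - 1%:M.
Proof.
move=> u; rewrite /cayley; have -> : 1%:M - X = 2 *: 1%:M - (1%:M + X).
  by rewrite scaler_nat mulr2n opprD addrA addrK.
by rewrite mulmxBl mulmxV // -scalemxAl mul1mx.
Qed.

Lemma add1_cayley X : 1%:M + X \in unitmx ->
  1%:M + cayley X = 2 *: invmx (1%:M + X).
Proof. by move=> u; rewrite cayleyE // addrC subrK. Qed.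

Lemma cayley_unit X : 1%:M + X \in unitmx -> 1%:M + cayley X \in unitmx.
Proof.
by move=> u; rewrite add1_cayley // unitmxZ ?unitfE ?pnatr_eq0 // unitmx_inv.
Qed.

Lemma cayleyK X : 1%:M + X \in unitmx -> cayley (cayley X) = X.
Proof.
move=> u; rewrite cayleyE ?cayley_unit // add1_cayley // invmxZ; last first.
  by rewrite unitmxZ ?unitfE ?pnatr_eq0 // unitmx_inv.
rewrite invmxK scalerA mulfV ?pnatr_eq0 // scale1r.
by rewrite addrC addKr.
Qed.

Lemma invmxB (P Q : M) : P \in unitmx -> Q \in unitmx ->
  invmx P - invmx Q = invmx P *m (Q - P) *m invmx Q.
Proof.
move=> uP uQ; rewrite mulmxBr mulVmx // mulmxBl mul1mx.
by rewrite -mulmxA mulmxV // mulmx1.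
Qed.

Lemma cayleyB X Y : 1%:M + X \in unitmx -> 1%:M + Y \in unitmx ->
  cayley X - cayley Y =
  2 *: (invmx (1%:M + X) *m (Y - X) *m invmx (1%:M + Y)).
Proof.
move=> uX uY; rewrite !cayleyE // opprB addrA subrK -scalerBr invmxB //.
congr (_ *: (_ *m _ *m _)).
by rewrite opprD addrACA subrr add0r.
Qed.

Lemma mink_adj_invmx A : A \in unitmx -> (invmx A)^*J *m A^*J = 1%:M.
Proof. by move=> u; rewrite -mink_adjM mulmxV // mink_adj1. Qed.

(** How far the transform of A is from the Lie algebra, in terms of how far A is
    from being an isometry. It is used in both directions: for an exact element
    of the Lie algebra it shows that the transform is an isometry, and for an
    approximate isometry it provides an error estimate. *)
Lemma cayley_defect A : 1%:M + A \in unitmx ->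
  cayley A + (cayley A)^*J =
  2 *: ((invmx (1%:M + A))^*J *m (1%:M - A^*J *m A) *m invmx (1%:M + A)).
Proof.
move=> u; rewrite cayleyE //; set W := invmx _.
rewrite mink_adjD mink_adjN mink_adj1 mink_adjZ.
have WA : (1%:M + A) *m W = 1%:M by exact: mulmxV.
have WA' : W^*J *m (1%:M + A^*J) = 1%:M.
  by rewrite -[X in _ *m (X + _)]mink_adj1 -mink_adjD mink_adj_invmx.
(* With P and Q the two factors, P + Q - P Q = 1 - (P - 1) (Q - 1). *)
set P := 1%:M + A^*J in WA' *; set Q := 1%:M + A in WA *.
have -> : 1%:M - A^*J *m A = P + Q - P *m Q.
  have -> : A^*J = P - 1%:M by rewrite addrC addKr.
  have -> : A = Q - 1%:M by rewrite addrC addKr.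
  rewrite mulmxBl !mulmxBr mulmx1 !mul1mx; move: (P *m Q) => S.
  by apply/matrixP => i j; rewrite !mxE; ring.
rewrite mulmxBr mulmxDr mulmxA WA' mul1mx mulmxBl mulmxDl mul1mx.
rewrite -[W^*J *m Q *m W]mulmxA WA mulmx1.
by apply/matrixP => i j; rewrite !mxE; ring.
Qed.

Lemma cayley_isometry X : 1%:M + X \in unitmx -> X^*J = - X ->
  (cayley X)^*J *m cayley X = 1%:M.
Proof.
move=> u hX.
have uC := cayley_unit u.
have := cayley_defect uC; rewrite cayleyK // hX subrr => /esym/eqP.
rewrite scaler_eq0 pnatr_eq0 /= => /eqP E.
have sandwich (P Q S P' Q' : M) : P *m Q = 1%:M -> Q' *m P' = 1%:M ->
    P *m (Q *m S *m Q') *m P' = S.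
  by move=> PQ QP; rewrite !mulmxA PQ mul1mx -mulmxA QP mulmx1.
have H := sandwich _ _ (1%:M - (cayley X)^*J *m cayley X) _ _
  (etrans (esym (mink_adjM _ _)) (etrans (congr1 mink_adj (mulVmx uC)) mink_adj1))
  (mulVmx uC).
by move: H; rewrite E mulmx0 mul0mx => /esym/eqP; rewrite subr_eq0 => /eqP.
Qed.

Lemma det_cayley X : 1%:M + X \in unitmx -> X^*J = - X -> \det (cayley X) = 1.
Proof.
move=> u hX; rewrite det_mulmx -{1}mink_adj1 -hX -mink_adjD det_mink_adj.
by rewrite -det_mulmx mulmxV // det1.
Qed.

(** A linear map of all matrices onto the Lie algebra. It lets the chart of the
    group be defined on a full matrix space, which is a complete normed
    space. *)
Definition skew Y : M := J *m (Y - Y^T).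

Lemma mink_adj_skew Y : (skew Y)^*J = - skew Y.
Proof.
rewrite /mink_adj /skew trmx_mul trmx_lorentz_J linearB /= trmxK.
by rewrite !mulmxA -mulmxA lorentz_J_sqr mulmx1 -mulmxN opprB.
Qed.

(** A matrix X close to [skew Y] is moved into the Lie algebra by a small change
    of the parameter Y, and the displacement of X is half its defect. *)
Lemma skew_correction Y X : let Z := X - skew Y in
  skew (Y + 2^-1 *: (J *m Z)) - X = - (2^-1 *: (X + X^*J)).
Proof.
move=> Z; have -> : skew (Y + 2^-1 *: (J *m Z)) = skew Y + 2^-1 *: (Z - Z^*J).
  rewrite /skew [(_ + _)^T]linearD /= opprD addrACA mulmxDr; congr (_ + _).
  rewrite linearZ /= -scalerBr -scalemxAr mulmxBr mulmxA lorentz_J_sqr mul1mx.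
  by rewrite trmx_mul trmx_lorentz_J mulmxA.
rewrite /Z mink_adjD mink_adjN mink_adj_skew.
by apply/matrixP => i j; rewrite !mxE; field.
Qed.

End Cayley.

(** * Perturbing approximate isometries *)

Section CayleyAnalysis.
Variables (R : realType) (d : nat).
Local Notation I := (eps_index R).
Local Notation M := 'M[R]_d.+1.
Local Notation J := (lorentz_J R d).

Lemma cvg_mx_bounded T (F : set_system T) {FF : Filter F} n p
    (A : T -> 'M[R]_(n, p)) (L : 'M[R]_(n, p)) :
  A t @[t --> F] --> L -> \forall t \near F, `|A t| <= `|L| + 1.
Proof.
move/cvgrPdist_le => /(_ 1 ltr01); apply: filterS => t ht.
have -> : A t = L - (L - A t) by rewrite subKr.
by apply: le_trans (ler_normB _ _) _; rewrite lerD2l.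
Qed.

Lemma negl_mx_sandwich (F : set_system I) {FF : Filter F} n
    (P N Q : I -> 'M[R]_n) k :
  @eps0 R `<=` F ->
  (\forall e \near F, `|P e| <= k) -> (\forall e \near F, `|Q e| <= k) ->
  negl F (fun e => `|N e|) -> negl F (fun e => `|P e *m N e *m Q e|).
Proof.
move=> F0 hP hQ hN b; near=> e.
rewrite normr_id; apply: le_trans (mx_norm_mulmx _ _) _.
have Pk : `|P e| <= k by near: e.
have Qk : `|Q e| <= k by near: e.
have Nb : `|N e| <= sval e `^ (b + 1).
  by rewrite -[leLHS]normr_id; near: e; exact: hN.
apply: (@le_trans _ _ (n%:R * (n%:R * (k * sval e `^ (b + 1)) * k))).
  apply: ler_wpM2l => //; apply: ler_pM => //.
  apply: le_trans (mx_norm_mulmx _ _) _.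
  by apply: ler_wpM2l => //; exact: ler_pM.
have -> : n%:R * (n%:R * (k * sval e `^ (b + 1)) * k) =
  (n%:R * n%:R * k * k) * sval e `^ (b + 1) by ring.
by near: e; apply: near_absorb => //; rewrite ltrDl.
Unshelve. all: by end_near. Qed.

Lemma cvg_cayley T (F : set_system T) {FF : Filter F} (X : T -> M) (L : M) :
  1%:M + L \in unitmx -> X t @[t --> F] --> L ->
  cayley (X t) @[t --> F] --> cayley L.
Proof.
move=> uL hX.
have hX1 : 1%:M + X t @[t --> F] --> 1%:M + L by apply: cvgD => //; exact: cvg_cst.
apply: cvg_mulmx; first by apply: cvgB => //; exact: cvg_cst.
by apply: cvg_invmx => //; exact: near_unitmx hX1.
Qed.

Lemma cvg_skew T (F : set_system T) {FF : Filter F} (Y : T -> M) (L : M) :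
  Y t @[t --> F] --> L -> skew (Y t) @[t --> F] --> skew L.
Proof.
move=> hY; apply: cvg_mulmx; first exact: cvg_cst.
by apply: cvgB => //; exact: cvg_trmx.
Qed.

(** A net of approximate isometries that tends to a point of the Cayley chart
    differs negligibly from a net of exact isometries. The transform of A e is
    projected to the Lie algebra and transformed back; [cayley_defect] bounds
    the resulting error by the failure of A e to be an isometry. *)
Lemma cayley_retraction (F : set_system I) {FF : Filter F} (A : I -> M) (Y0 : M) :
  @eps0 R `<=` F -> 1%:M + skew Y0 \in unitmx ->
  A e @[e --> F] --> cayley (skew Y0) ->
  negl F (fun e => `|(A e)^T *m J *m A e - J|) ->
  exists2 Y : I -> M, Y e @[e --> F] --> Y0 &
    negl F (fun e => `|A e - cayley (skew (Y e))|).
Proof.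
move=> F0 uX0 hA nA; pose X e := cayley (A e).
have uA0 : 1%:M + cayley (skew Y0) \in unitmx by exact: cayley_unit.
have hA1 : 1%:M + A e @[e --> F] --> 1%:M + cayley (skew Y0).
  by apply: cvgD => //; exact: cvg_cst.
have uA : \forall e \near F, 1%:M + A e \in unitmx.
  exact: near_unitmx uA0 hA1.
have hX : X e @[e --> F] --> skew Y0.
  have H := cvg_cayley uA0 hA; rewrite (cayleyK uX0) in H; exact: H.
pose Y e := Y0 + 2^-1 *: (J *m (X e - skew Y0)).
have hY : Y e @[e --> F] --> Y0.
  have : Y e @[e --> F] --> Y0 + 2^-1 *: (J *m (skew Y0 - skew Y0)).
    apply: cvgD; first exact: cvg_cst.
    apply: cvgZ; first exact: cvg_cst.
    apply: cvg_mulmx; first exact: cvg_cst.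
    by apply: cvgB => //; exact: cvg_cst.
  by rewrite subrr mulmx0 scaler0 addr0.
exists Y => //.
have hX1 : 1%:M + X e @[e --> F] --> 1%:M + skew Y0.
  by apply: cvgD => //; exact: cvg_cst.
have hS1 : 1%:M + skew (Y e) @[e --> F] --> 1%:M + skew Y0.
  by apply: cvgD; [exact: cvg_cst|exact: cvg_skew].
have uS : \forall e \near F, 1%:M + skew (Y e) \in unitmx.
  exact: near_unitmx uX0 hS1.
have uX : \forall e \near F, 1%:M + X e \in unitmx.
  exact: near_unitmx uX0 hX1.
pose P e := invmx (1%:M + A e).
have hP : P e @[e --> F] --> invmx (1%:M + cayley (skew Y0)).
  exact: (cvg_invmx uA0 uA hA1).
have hPJ : mink_adj (P e) @[e --> F] --> mink_adj (invmx (1%:M + cayley (skew Y0))).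
  apply: cvg_mulmx; last exact: cvg_cst.
  by apply: cvg_mulmx; [exact: cvg_cst|exact: cvg_trmx].
have hQ : invmx (1%:M + X e) @[e --> F] --> invmx (1%:M + skew Y0).
  exact: (cvg_invmx uX0 uX hX1).
have hQ2 : 2 *: invmx (1%:M + X e) @[e --> F] --> 2 *: invmx (1%:M + skew Y0).
  by apply: cvgZ => //; exact: cvg_cst.
have hS : invmx (1%:M + skew (Y e)) @[e --> F] --> invmx (1%:M + skew Y0).
  exact: (cvg_invmx uX0 uS hS1).
have sandwich (B N C : I -> M) (LB LC : M) : B e @[e --> F] --> LB ->
    C e @[e --> F] --> LC -> negl F (fun e => `|N e|) ->
    negl F (fun e => `|B e *m N e *m C e|).
  move=> hB hC; apply: (@negl_mx_sandwich _ _ _ _ _ _ (`|LB| + `|LC| + 1)) => //.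
    apply: filterS (cvg_mx_bounded hB) => e he; apply: le_trans he _.
    by rewrite addrAC lerDl.
  apply: filterS (cvg_mx_bounded hC) => e he; apply: le_trans he _.
  by rewrite -addrA lerDr.
have nJ : negl F (fun e => `|J *m ((A e)^T *m J *m A e - J) *m 1%:M|).
  by apply: sandwich nA; exact: cvg_cst.
have nG := sandwich _ _ _ _ _ hQ2 hS (sandwich _ _ _ _ _ hPJ hP nJ).
move=> b; near=> e.
have uAe : 1%:M + A e \in unitmx by near: e; exact: uA.
have uXe : 1%:M + X e \in unitmx by near: e; exact: uX.
have uSe : 1%:M + skew (Y e) \in unitmx by near: e; exact: uS.
suff -> : A e - cayley (skew (Y e)) = 2 *: invmx (1%:M + X e) *m
    (mink_adj (P e) *m (J *m ((A e)^T *m J *m A e - J) *m 1%:M) *m P e) *m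
    invmx (1%:M + skew (Y e)).
  near: e; exact: nG.
have -> : J *m ((A e)^T *m J *m A e - J) *m 1%:M =
    - (1%:M - mink_adj (A e) *m A e).
  by rewrite mulmx1 (mulmxBr J) lorentz_J_sqr mink_adj_mul opprB.
rewrite -{1}(cayleyK uAe) cayleyB // /Y skew_correction cayley_defect //.
rewrite scalerA mulVf ?pnatr_eq0 // scale1r -/(P e).
by rewrite !(mulmxN, mulNmx) -!scalemxAl ?scalerN.
Unshelve. all: by end_near. Qed.

(** Passing to an ultrafilter replaces the extraction of subsequences. *)
Lemma cvg_ultra_bounded (G : set_system I) (x : I -> R) (k : R) :
  UltraFilter G -> (\forall e \near G, `|x e| <= k) ->
  exists l : R, x e @[e --> G] --> l.
Proof.
move=> UG hk.
have hI : (x @ G) `[- k, k]%classic.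
  by apply: filterS hk => e he; rewrite /preimage /= in_itv /= -ler_norml.
have [l [_ hl]] := @segment_compact R (- k) k (x @ G) _ hI.
exists l => U nU.
have [//|nG] := in_ultra_setVsetC (x @^-1` U) UG.
have xG : G (x @^-1` (x @` (~` (x @^-1` U)))).
  by apply: filterS nG => e ne; exists e.
have [y [[e ne xe] Uy]] := hl _ _ xG nU.
by case: ne; rewrite /preimage /= xe.
Qed.

Lemma cvg_ultra_bounded_mx (G : set_system I) n p (A : I -> 'M[R]_(n, p)) k :
  UltraFilter G -> (\forall e \near G, `|A e| <= k) ->
  exists L : 'M[R]_(n, p), A e @[e --> G] --> L.
Proof.
move=> UG hk.
have /choice[L hL] : forall ij : 'I_n * 'I_p, exists l : R,
    A e ij.1 ij.2 @[e --> G] --> l.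
  move=> [i j]; apply: (@cvg_ultra_bounded _ _ k UG).
  by apply: filterS hk => e; exact/le_trans/mx_entry_le_norm.
exists (\matrix_(i, j) L (i, j)); apply: cvg_mx => i j.
by rewrite mxE; exact: (hL (i, j)).
Qed.

End CayleyAnalysis.

(** * Uniformity from the Baire category theorem *)

HB.instance Definition _ (R : realType) (m n : nat) :=
  Uniform_isComplete.Build 'M[R]_(m, n) cauchy_cvg.

Section UniformInvariance.
Variables (R : realType) (d : nat).
Local Notation I := (eps_index R).
Local Notation M := 'M[R]_d.+1.
Local Notation V := 'cV[R]_d.+1.
Local Notation disc r := [set x : V | `|x| <= r].

Lemma near_eps0P (P : set I) : (\forall e \near @eps0 R, P e) ->
  exists2 c : R, 0 < c & forall e, sval e < c -> P e.
Proof.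
rewrite /eps0 /= => /nbhs_ballP[c /= c0 h]; exists c => // e ec.
have /= H := h (sval e).
case: e ec H => e he /= ec H; apply: H; last by case/andP: he.
by case/andP: he => e0 _; rewrite /ball /= sub0r normrN gtr0_norm.
Qed.

Lemma lorentz_cayley (X : M) : 1%:M + X \in unitmx -> mink_adj X = - X ->
  0 < cayley X ord0 ord0 -> lorentz (cayley X).
Proof.
move=> u hX c0; apply: lorentz_of_isometry => //; last exact: det_cayley.
by apply: mink_orthogonalP; exact: cayley_isometry.
Qed.

(** Near the identity, which is the transform of 0, the first entry remains
    positive; the other conditions hold for every transform. *)
Lemma near_skew_lorentz : exists2 rho : R, 0 < rho & forall Y : M, `|Y| < rho ->
  1%:M + skew Y \in unitmx /\ lorentz (cayley (skew Y)).
Proof.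
have s0 : skew (0 : M) = 0 by rewrite /skew trmx0 subr0 mulmx0.
have hid : Y @[Y --> nbhs (0 : M)] --> (0 : M) by exact: cvg_id.
have hs : skew Y @[Y --> nbhs (0 : M)] --> (0 : M).
  by have H := cvg_skew hid; rewrite s0 in H; exact: H.
have u1 : 1%:M + (0 : M) \in unitmx by rewrite addr0 unitmx1.
have hs1 : 1%:M + skew Y @[Y --> nbhs (0 : M)] --> 1%:M + (0 : M).
  by apply: cvgD => //; exact: cvg_cst.
have hu : \forall Y \near nbhs (0 : M), 1%:M + skew Y \in unitmx.
  exact: near_unitmx u1 hs1.
have hc : cayley (skew Y) ord0 ord0 @[Y --> nbhs (0 : M)] -->
    (cayley (0 : M)) ord0 ord0.
  by apply: cvg_mx_entry; exact: cvg_cayley.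
have hp : \forall Y \near nbhs (0 : M), 0 < cayley (skew Y) ord0 ord0.
  apply: (cvgr_gt _ hc).
  by rewrite /cayley addr0 subr0 invmx1 mulmx1 mxE.
have : nbhs (0 : M) ([set Y | 1%:M + skew Y \in unitmx] `&`
    [set Y | 0 < cayley (skew Y) ord0 ord0]) by exact: filterI.
move=> /nbhs_ballP[rho /= rho0 h].
exists rho => // Y hY; have [|uY cY] := h Y.
  by rewrite -ball_normE /= sub0r normrN.
by split => //; apply: lorentz_cayley => //; exact: mink_adj_skew.
Qed.

(** Each Lorentz matrix satisfies the estimate for small epsilon, but how small
    depends on the matrix. On a ball of parameters, let O n contain the
    parameters that violate the estimate for some epsilon below 1 / (n + 1). The
    O n are open, by continuity of u, and no parameter of the ball lies in all
    of them. By Baire's theorem some O n is not dense, so the estimate is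
    uniform on an open set of parameters. *)
Lemma locally_uniform_invariance (u : I -> V -> R) (r b : R) :
  (forall e, continuous (u e)) ->
  (forall g : M, lorentz g ->
     negl_on (@eps0 R) (disc r) (fun e x => u e (g *m x) - u e x)) ->
  exists Y0 : M, [/\ 1%:M + skew Y0 \in unitmx, lorentz (cayley (skew Y0)) &
    exists delta c : R, [/\ 0 < delta, 0 < c & forall Y : M, `|Y - Y0| < delta ->
      forall e, sval e < c -> forall x, `|x| <= r ->
        `|u e (cayley (skew Y) *m x) - u e x| <= sval e `^ b]].
Proof.
move=> cu inv; have [rho rho0 good] := near_skew_lorentz.
pose defect (Y : M) e x := `|u e (cayley (skew Y) *m x) - u e x|.
(* Parameters of norm above rho / 2 are put into every O n, so that an open set
   that misses O n lies in the ball where the chart takes Lorentz values. *)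
pose O (n : nat) : set M := [set Y | rho / 2 < `|Y|] `|`
  [set Y | `|Y| < rho /\ exists e x, [/\ sval e < n.+1%:R^-1, `|x| <= r &
                                       sval e `^ b < defect Y e x]].
have openO n : open (O n).
  rewrite openE => Y [hY|[hY [e [x [en xr hd]]]]].
    near=> Z; left => /=; near: Z.
    apply: (cvgr_gt `|Y|) => //; exact: norm_continuous.
  have [uY _] := good Y hY.
  have cd : defect Z e x @[Z --> nbhs Y] --> defect Y e x.
    apply: cvg_norm; apply: cvgB; last exact: cvg_cst.
    have hid : Z @[Z --> nbhs Y] --> Y by exact: cvg_id.
    have hm : cayley (skew Z) *m x @[Z --> nbhs Y] --> cayley (skew Y) *m x.
      apply: cvg_mulmx; last exact: cvg_cst.
      by apply: cvg_cayley => //; exact: cvg_skew.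
    exact: cvg_comp hm (cu e _).
  near=> Z; right; split => /=.
    near: Z; apply: (cvgr_lt `|Y|) => //; exact: norm_continuous.
  exists e, x; split => //; near: Z; exact: (cvgr_gt (defect Y e x)).
have [n nd] : exists n, ~ dense (O n).
  apply: contrapT => /forallNP dO.
  have dn n : dense (O n) by apply: contrapT; exact: dO.
  have ball0 : ball (0 : M) (rho / 2) !=set0.
    by exists 0; apply: ballxx; rewrite divr_gt0.
  have [Y [bY OY]] := Baire (fun n => conj (openO n) (dn n)) ball0 (ball_open _ _).
  have Y2 : `|Y| < rho / 2 by move: bY; rewrite -ball_normE /= sub0r normrN.
  have Yr : `|Y| < rho by apply: lt_trans Y2 _; rewrite ltr_pdivrMr // ltr_pMr // ltr1n.
  have [_ lY] := good Y Yr.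
  have [c c0 hc] := near_eps0P (inv _ lY b).
  have [k hk] : exists k : nat, k.+1%:R^-1 < c.
    exists (Num.truncn c^-1).
    rewrite invf_plt ?posrE //.
    by rewrite truncnS_gt.
  have [|[_ [e [x [ek xr]]]]] := OY k Logic.I.
    by rewrite /= ltNge (ltW Y2).
  by rewrite ltNge (hc e (lt_trans ek hk) x xr).
move: nd => /existsNP[W /not_implyP[[Y0 WY0] /not_implyP[oW hW]]].
have notO Y : W Y -> ~ O n Y by move=> WY OY; apply: hW; exists Y.
have small Y : W Y -> `|Y| < rho.
  move=> WY; have := notO Y WY; rewrite /O /= => /not_orP[/negP + _].
  rewrite -leNgt => /le_lt_trans; apply.
  by rewrite ltr_pdivrMr // ltr_pMr // ltr1n.
have [uY0 lY0] := good Y0 (small _ WY0).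
exists Y0; split => //.
have /nbhs_ballP[delta /= delta0 hdelta] : nbhs Y0 W by exact: open_nbhs_nbhs.
exists delta, n.+1%:R^-1; split => // Y hY e en x xr.
have WY : W Y by apply: hdelta; rewrite -ball_normE /= distrC.
rewrite leNgt; apply/negP => hd; apply: (notO Y WY); right; split => /=.
  exact: small.
by exists e, x.
Unshelve. all: by end_near. Qed.

End UniformInvariance.

(** * Invariance under nets of approximate Lorentz matrices *)

Section GeneralizedInvariance.
Variables (R : realType) (d : nat).
Local Notation I := (eps_index R).
Local Notation M := 'M[R]_d.+1.
Local Notation V := 'cV[R]_d.+1.
Local Notation J := (lorentz_J R d).
Local Notation disc r := [set x : V | `|x| <= r].

Lemma negl_cvg0 (F : set_system I) {FF : Filter F} (x : I -> R) :
  @eps0 R `<=` F -> negl F x -> x e @[e --> F] --> (0 : R).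
Proof.
move=> F0 hx; apply/cvgr0Pnorm_lt => k k0; near=> e.
apply: (@le_lt_trans _ _ (sval e)); last by near: e; exact: near_eps_lt.
rewrite -(powRr1 (ltW (eps_gt0 e))).
near: e; exact: (hx 1).
Unshelve. all: by end_near. Qed.

Lemma mul_lorentz_J_entry (A B : M) i j : (A *m J *m B) i j =
  A i ord0 * B ord0 j - \sum_(k < d) A i (lift ord0 k) * B (lift ord0 k) j.
Proof.
rewrite mxE /lorentz_J mul_mx_diag big_ord_recl !mxE /= mulr1.
congr (_ + _); rewrite -sumrN; apply: eq_bigr => k _.
by rewrite !mxE /= mulrN1 mulNr.
Qed.

Lemma isometry_entry00 (A : M) : A^T *m J *m A = J -> 0 <= A ord0 ord0 ->
  0 < A ord0 ord0.
Proof.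
move=> hA A0; rewrite lt_neqAle A0 andbT eq_sym; apply/eqP => A00.
have := congr1 (fun B : M => B ord0 ord0) hA.
rewrite mul_lorentz_J_entry !mxE A00 /= mul0r sub0r mulr1n => H.
have : 0 <= \sum_(k < d) A^T ord0 (lift ord0 k) * A (lift ord0 k) ord0.
  by apply: sumr_ge0 => k _; rewrite mxE -expr2 sqr_ge0.
by rewrite -[X in 0 <= X]opprK H oppr_ge0 ler10.
Qed.

Lemma isometry_trmx (A : M) : A^T *m J *m A = J -> A *m J *m A^T = J.
Proof.
move=> hA; have : mink_adj A *m A = 1%:M by rewrite mink_adj_mul hA lorentz_J_sqr.
move/mulmx1C; rewrite /mink_adj !mulmxA => H.
by rewrite -[RHS]mul1mx -H -[RHS]mulmxA lorentz_J_sqr mulmx1.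
Qed.

Lemma isometry_invmx (A : M) : A^T *m J *m A = J -> invmx A = mink_adj A.
Proof.
move=> hA; have H : mink_adj A *m A = 1%:M by rewrite mink_adj_mul hA lorentz_J_sqr.
have [_ uA] := mulmx1_unit H.
by rewrite -[LHS]mul1mx -H -mulmxA mulmxV // mulmx1.
Qed.

(** A reverse Cauchy-Schwarz inequality. If a and b are the first rows of A and
    B, with first entries a0, b0 and remaining parts a', b', the entry is
    a0 b0 - <a', b'>, where |a'|^2 = a0^2 - 1 and |b'|^2 = b0^2 - 1. It is
    positive because |t a' - b'|^2 >= 0 for t = b0 / a0. *)
Lemma orthochronous_mul_invmx (A B : M) :
  A^T *m J *m A = J -> B^T *m J *m B = J ->
  0 < A ord0 ord0 -> 0 < B ord0 ord0 -> 0 < (A *m invmx B) ord0 ord0.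
Proof.
move=> hA hB A0 B0.
have row_norm (C : M) : C^T *m J *m C = J ->
    \sum_(k < d) C ord0 (lift ord0 k) ^+ 2 = C ord0 ord0 ^+ 2 - 1.
  move/isometry_trmx/(congr1 (fun N : M => N ord0 ord0)).
  rewrite mul_lorentz_J_entry !mxE /= mulr1n => H.
  rewrite -[X in _ = _ - X]H opprB addrC expr2 subrK.
  by apply: eq_bigr => k _; rewrite mxE expr2.
have -> : (A *m invmx B) ord0 ord0 = A ord0 ord0 * B ord0 ord0 -
    \sum_(k < d) A ord0 (lift ord0 k) * B ord0 (lift ord0 k).
  rewrite (isometry_invmx hB) /mink_adj !mulmxA.
  rewrite [_ *m J]mul_mx_diag !mxE /= mulr1.
  transitivity ((A *m J *m B^T) ord0 ord0); first by rewrite mxE.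
  rewrite mul_lorentz_J_entry mxE; congr (_ - _).
  by apply: eq_bigr => k _; rewrite mxE.
set S := \sum_(k < d) _.
pose t := B ord0 ord0 / A ord0 ord0.
have t0 : 0 < t by rewrite divr_gt0.
have : 0 <= \sum_(k < d) (t * A ord0 (lift ord0 k) - B ord0 (lift ord0 k)) ^+ 2.
  by apply: sumr_ge0 => k _; exact: sqr_ge0.
have -> : \sum_(k < d) (t * A ord0 (lift ord0 k) - B ord0 (lift ord0 k)) ^+ 2 =
  t ^+ 2 * (A ord0 ord0 ^+ 2 - 1) - 2 * t * S + (B ord0 ord0 ^+ 2 - 1).
  rewrite -!row_norm // /S !big_distrr /= -sumrB -big_split /=.
  by apply: eq_bigr => k _; ring.
have tA : t * A ord0 ord0 = B ord0 ord0 by rewrite /t divfK // gt_eqF.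
move=> H; have : 0 < t * (A ord0 ord0 * B ord0 ord0 - S).
  have t2 : 0 < t ^+ 2 by rewrite exprn_gt0.
  by move: H t2; rewrite -tA => H t2; nra.
by rewrite pmulr_rgt0.
Qed.

(** If the estimate failed, it would fail along some ultrafilter G, along which
    A e tends to a Lorentz matrix g. Let g0 be the Lorentz matrix around which
    invariance is uniform, and h = g0 g^-1. Then h A e tends to g0, hence it is
    negligibly close to Lorentz matrices B e in the region of uniformity, and
    u (A x), u (h A x), u (B x) and u x are successively negligibly close: by
    invariance under the single matrix h, by moderateness, and by
    uniformity. *)
Lemma generalized_invariance (u : I -> V -> R) (A : I -> M) (K : R) :
  smooth_moderate u ->
  (forall g : M, lorentz g -> forall r,
     negl_on (@eps0 R) (disc r) (fun e x => u e (g *m x) - u e x)) ->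
  (\forall e \near @eps0 R, `|A e| <= K) ->
  negl (@eps0 R) (fun e => `|(A e)^T *m J *m A e - J|) ->
  negl (@eps0 R) (fun e => \det (A e) - 1) ->
  (forall k, 0 < k -> \forall e \near @eps0 R, - k < A e ord0 ord0) ->
  forall r, negl_on (@eps0 R) (disc r) (fun e x => u e (A e *m x) - u e x).
Proof.
move=> mu inv bA nA nd pA r b.
set P := [set e : I | forall x, disc r x -> `|u e (A e *m x) - u e x| <= sval e `^ b].
apply: contrapT => nP.
have within_proper : ProperFilter (within (~` P) (@eps0 R)).
  split; last exact: within_filter.
  move=> h; have h' : \forall e \near @eps0 R, ~ ~ P e := h.
  by apply: nP; apply: filterS h' => e he; exact: contrapT.
have [G [UG sG]] := ultraFilterLemma within_proper.
have G0 : @eps0 R `<=` G by move=> Q hQ; apply: sG; apply: filterS hQ => e.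
have GnP : G (~` P) by apply: sG; apply: nearW.
have GP : ProperFilter G by exact: ultra_proper.
have GF : Filter G by exact: filter_filter.
have [g hg] := cvg_ultra_bounded_mx UG (G0 _ bA).
have isog : g^T *m J *m g = J.
  have c1 : (A e)^T *m J *m A e - J @[e --> G] --> g^T *m J *m g - J.
    apply: cvgB; last exact: cvg_cst.
    apply: cvg_mulmx => //; apply: cvg_mulmx; last exact: cvg_cst.
    exact: cvg_trmx.
  have c2 : `|(A e)^T *m J *m A e - J| @[e --> G] --> (0 : R).
    by apply: negl_cvg0 => // k; apply: G0; exact: nA.
  have /eqP : `|g^T *m J *m g - J| = 0.
    exact: (cvg_unique (@norm_hausdorff R R) (cvg_norm c1) c2).
  by rewrite normr_eq0 subr_eq0 => /eqP.
have detg : \det g = 1.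
  have c1 : \det (A e) - 1 @[e --> G] --> \det g - 1.
    by apply: cvgB; [exact: cvg_det|exact: cvg_cst].
  have c2 : \det (A e) - 1 @[e --> G] --> (0 : R).
    by apply: negl_cvg0 => // k; apply: G0; exact: nd.
  have /eqP : \det g - 1 = 0.
    exact: (cvg_unique (@norm_hausdorff R R) c1 c2).
  by rewrite subr_eq0 => /eqP.
have g00 : 0 <= g ord0 ord0.
  rewrite leNgt; apply/negP => gneg.
  have k0 : 0 < - (g ord0 ord0 / 2) by rewrite oppr_gt0 pmulr_llt0.
  have hg00 : A e ord0 ord0 @[e --> G] --> g ord0 ord0 by exact: cvg_mx_entry.
  have glt : g ord0 ord0 < g ord0 ord0 / 2.
    by rewrite ltr_pdivlMr // mulr_natr mulr2n gtrDl.
  have h1 : \forall e \near G, A e ord0 ord0 < g ord0 ord0 / 2.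
    exact: (cvgr_lt _ hg00).
  have [e [/= e1 e2]] := filter_ex (filterI h1 (G0 _ (pA _ k0))).
  by move: e2; rewrite opprK ltNge (ltW e1).
have ug : g \in unitmx by rewrite unitmxE detg unitr1.
have [Y0 [uY0 lY0 [delta [c [delta0 c0 hloc]]]]] :=
  @locally_uniform_invariance R d u r (b + 1)
    (fun e => smooth_continuous (mu.1 e)) (fun h lh => inv h lh r).
set g0 := cayley (skew Y0) in lY0.
have isog0 : g0^T *m J *m g0 = J.
  apply: mink_orthogonalP; apply: cayley_isometry => //; exact: mink_adj_skew.
pose h := g0 *m invmx g.
have isoh : h^T *m J *m h = J.
  have -> : h^T *m J *m h = (invmx g)^T *m (g0^T *m J *m g0) *m invmx g.
    by rewrite /h trmx_mul !mulmxA.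
  rewrite isog0 -{1}isog.
  have -> : (invmx g)^T *m (g^T *m J *m g) *m invmx g =
      (g *m invmx g)^T *m J *m (g *m invmx g) by rewrite trmx_mul !mulmxA.
  by rewrite mulmxV // trmx1 mul1mx mulmx1.
have deth : \det h = 1.
  by rewrite det_mulmx det_inv detg invr1 mulr1 det_cayley //; exact: mink_adj_skew.
have lh : lorentz h.
  apply: lorentz_of_isometry => //; apply: orthochronous_mul_invmx => //.
    by case: lY0.
  exact: isometry_entry00.
pose A' e := h *m A e.
have hA' : A' e @[e --> G] --> g0.
  have H : A' e @[e --> G] --> h *m g by apply: cvg_mulmx => //; exact: cvg_cst.
  by rewrite /h -mulmxA mulVmx // mulmx1 in H.
have nA' : negl G (fun e => `|(A' e)^T *m J *m A' e - J|).
  move=> k; have H := G0 _ (nA k); apply: filterS H => e.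
  suff -> : (A' e)^T *m J *m A' e = (A e)^T *m J *m A e by [].
  by rewrite -[in RHS]isoh /A' trmx_mul !mulmxA.
have [Y hY nY] := cayley_retraction G0 uY0 hA' nA'.
have bB : \forall e \near G, `|cayley (skew (Y e))| <= `|g0| + 1.
  by apply: cvg_mx_bounded; apply: cvg_cayley => //; exact: cvg_skew.
have n1 := smooth_net_substitution r G0 mu (cvg_mx_bounded hA') bB nY.
have n2 := inv h lh (d.+1%:R * (K * r)) (b + 1).
have P1 : \forall e \near G, P e.
  near=> e => x xr.
  have bAe : `|A e| <= K by near: e; exact: G0.
  have Yd : `|Y e - Y0| < delta.
    rewrite distrC; near: e; move/cvgrPdist_lt: hY; exact.
  have ec : sval e < c by near: e; exact: near_eps_lt.
  have e1 : `|u e (A' e *m x) - u e (cayley (skew (Y e)) *m x)| <= sval e `^ (b + 1).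
    by move: x xr; near: e; exact: n1.
  have e2 := hloc _ Yd e ec x xr.
  have e3 : `|u e (h *m (A e *m x)) - u e (A e *m x)| <= sval e `^ (b + 1).
    have H : forall y : V, `|y| <= d.+1%:R * (K * r) ->
      `|u e (h *m y) - u e y| <= sval e `^ (b + 1) by near: e; exact: G0.
    by apply: H; exact: mulmx_disc.
  have e4 : 3 * sval e `^ (b + 1) <= sval e `^ b.
    by near: e; apply: near_absorb => //; rewrite ltrDl.
  apply: le_trans e4; rewrite mulmxA -/(A' e) in e3.
  have -> : u e (A e *m x) - u e x =
    - (u e (A' e *m x) - u e (A e *m x)) +
    (u e (A' e *m x) - u e (cayley (skew (Y e)) *m x)) +
    (u e (cayley (skew (Y e)) *m x) - u e x) by ring.
  apply: le_trans (ler_normD _ _) _.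
  apply: le_trans (lerD (ler_normD _ _) (lexx _)) _; rewrite normrN.
  by have := lerD (lerD e3 e1) e2; lra.
by have [e []] := filter_ex (filterI P1 GnP).
Unshelve. all: by end_near. Qed.

End GeneralizedInvariance.

(** * Representatives of generalized matrices *)

Section GeneralizedNumbers.
Variable R : realType.
Local Notation I := (eps_index R).
Local Open Scope quotient_scope.

(** The projection to generalized numbers and, for each epsilon, the evaluation
    of representatives are ring morphisms: a polynomial identity between
    generalized matrices holds for the representatives, up to a negligible
    error. *)
Definition greal_pi (x : bnet R) : greal R := \pi x.

Lemma greal_pi_is_zmod_morphism : zmod_morphism greal_pi.
Proof. by move=> x y; rewrite /greal_pi !piE. Qed.

Lemma greal_pi_is_monoid_morphism : monoid_morphism greal_pi.
Proof. by split=> [|x y]; rewrite /greal_pi !piE. Qed.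

HB.instance Definition _ := GRing.isZmodMorphism.Build (bnet R) (greal R)
  greal_pi greal_pi_is_zmod_morphism.
HB.instance Definition _ := GRing.isMonoidMorphism.Build (bnet R) (greal R)
  greal_pi greal_pi_is_monoid_morphism.

Lemma greal_piK (x : greal R) : greal_pi (repr x) = x.
Proof. exact: reprK. Qed.

Lemma greal_pi_eq (x y : bnet R) : greal_pi x = greal_pi y ->
  negl (@eps0 R) (fun e => x e - y e).
Proof.
move=> /eqP; rewrite -Quotient.idealrBE => /bnet_negligibleP h b.
have /bigO_powP[k k0 hk] := h (b + 1); near=> e.
have h1 : `|(x - y) e| <= k * sval e `^ (b + 1) by near: e.
apply: le_trans h1 _; near: e; apply: near_absorb => //; by rewrite ltrDl.
Unshelve. all: by end_near. Qed.

Definition bnet_eval (e : I) (x : bnet R) : R := x e.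

Lemma bnet_eval_is_zmod_morphism e : zmod_morphism (bnet_eval e).
Proof. by []. Qed.

Lemma bnet_eval_is_monoid_morphism e : monoid_morphism (bnet_eval e).
Proof. by []. Qed.

HB.instance Definition _ e := GRing.isZmodMorphism.Build (bnet R) R
  (bnet_eval e) (bnet_eval_is_zmod_morphism e).
HB.instance Definition _ e := GRing.isMonoidMorphism.Build (bnet R) R
  (bnet_eval e) (bnet_eval_is_monoid_morphism e).

Lemma map_lorentz_J (S T : comNzRingType) (phi : {rmorphism S -> T}) d :
  map_mx phi (lorentz_J S d) = lorentz_J T d.
Proof.
rewrite /lorentz_J map_diag_mx; congr diag_mx; apply/rowP => i.
by rewrite !mxE; case: ifP; rewrite ?rmorphN rmorph1.
Qed.

Lemma bounded_entries_mx (F : set_system I) {FF : Filter F} n p (A : I -> 'M[R]_(n, p)) :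
  (forall i j, exists k, \forall e \near F, `|A e i j| <= k) ->
  exists K, \forall e \near F, `|A e| <= K.
Proof.
move=> h; have /choice[k hk] : forall ij : 'I_n * 'I_p, exists k,
    \forall e \near F, `|A e ij.1 ij.2| <= k by move=> [i j]; exact: h.
exists (\sum_ij `|k ij|).
have H : \forall e \near F, forall ij, `|A e ij.1 ij.2| <= k ij.
  by apply: (@filter_forall I _ (fun ij e => `|A e ij.1 ij.2| <= k ij)).
apply: filterS H => e he; apply: mx_norm_le => [|i j]; first exact: sumr_ge0.
apply: le_trans (he (i, j)) _; apply: le_trans (ler_norm _) _.
by rewrite (bigD1 (i, j)) //= lerDl sumr_ge0.
Qed.

Lemma negl_entries_mx (F : set_system I) {FF : Filter F} n p (A : I -> 'M[R]_(n, p)) :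
  (forall i j, negl F (fun e => A e i j)) -> negl F (fun e => `|A e|).
Proof.
move=> h b.
have H : \forall e \near F, forall ij : 'I_n * 'I_p, `|A e ij.1 ij.2| <= sval e `^ b.
  apply: (@filter_forall I _ (fun ij e => `|A e ij.1 ij.2| <= sval e `^ b)).
  by move=> -[i j]; exact: h.
apply: filterS H => e he; rewrite normr_id.
by apply: mx_norm_le => [|i j]; [exact: powR_ge0|exact: (he (i, j))].
Qed.

Lemma greal_mx_eps_bounded n (A : 'M[greal R]_n) :
  exists K, \forall e \near @eps0 R, `|greal_mx_eps A e| <= K.
Proof.
apply: bounded_entries_mx => i j.
have /bounded_netP[k hk] := bnet_bounded (repr (A i j)).
by exists k; apply: filterS hk => e; rewrite mxE.
Qed.

Definition mx_repr n (A : 'M[greal R]_n) : 'M[bnet R]_n := map_mx repr A.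

Lemma mx_reprK n (A : 'M[greal R]_n) : map_mx greal_pi (mx_repr A) = A.
Proof. by apply/matrixP => i j; rewrite !mxE greal_piK. Qed.

Lemma mx_repr_eval n (A : 'M[greal R]_n) e :
  map_mx (bnet_eval e) (mx_repr A) = greal_mx_eps A e.
Proof. by apply/matrixP => i j; rewrite !mxE. Qed.

Lemma greal_mx_eps_isometry d (A : 'M[greal R]_d.+1) :
  A^T *m lorentz_J _ d *m A = lorentz_J _ d ->
  negl (@eps0 R) (fun e => `|(greal_mx_eps A e)^T *m lorentz_J R d *m
     greal_mx_eps A e - lorentz_J R d|).
Proof.
move=> hA; apply: negl_entries_mx => i j.
have E (S : comNzRingType) (phi : {rmorphism bnet R -> S}) :
    map_mx phi ((mx_repr A)^T *m lorentz_J _ d *m mx_repr A) =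
    (map_mx phi (mx_repr A))^T *m lorentz_J _ d *m map_mx phi (mx_repr A).
  by rewrite !map_mxM map_trmx map_lorentz_J.
have := E _ greal_pi; rewrite mx_reprK hA -(map_lorentz_J greal_pi).
move=> /(congr1 (fun N : 'M[greal R]_d.+1 => N i j)); rewrite [LHS]mxE [RHS]mxE.
move/greal_pi_eq => H b; apply: filterS (H b) => e.
have := congr1 (fun N : 'M[R]_d.+1 => N i j) (E R (bnet_eval e)).
rewrite [LHS]mxE mx_repr_eval => E1.
have := congr1 (fun N : 'M[R]_d.+1 => N i j) (map_lorentz_J (bnet_eval e) d).
rewrite [LHS]mxE => E2.
have mxB (N P : 'M[R]_d.+1) : (N - P) i j = N i j - P i j by rewrite !mxE.
by rewrite mxB -E1 -E2.
Qed.

Lemma greal_mx_eps_det n (A : 'M[greal R]_n) : \det A = 1 ->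
  negl (@eps0 R) (fun e => \det (greal_mx_eps A e) - 1).
Proof.
move=> dA; have : greal_pi (\det (mx_repr A)) = greal_pi 1.
  by rewrite -det_map_mx mx_reprK dA rmorph1.
move/greal_pi_eq => H b; apply: filterS (H b) => e.
by rewrite -mx_repr_eval det_map_mx.
Qed.

Lemma greal_pos_eps n (A : 'M[greal R]_n) i j : greal_pos (A i j) ->
  forall k, 0 < k -> \forall e \near @eps0 R, - k < greal_mx_eps A e i j.
Proof.
move=> [x xA x0] k k0.
have /greal_pi_eq h : greal_pi x = greal_pi (repr (A i j)) by rewrite greal_piK.
near=> e; rewrite mxE.
have xe : 0 < x e by near: e.
have : `|x e - (repr (A i j) : bnet R) e| <= sval e `^ 1 by near: e; exact: h.
rewrite (powRr1 (ltW (eps_gt0 e))) ler_norml => /andP[_].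
have : sval e < k by near: e; exact: eps0_lt.
lra.
Unshelve. all: by end_near. Qed.

Lemma greal_mx_eps_cst n (g : 'M[R]_n) :
  negl (@eps0 R) (fun e => `|g - greal_mx_eps (map_mx (@greal_cst R) g) e|).
Proof.
apply: negl_entries_mx => i j.
have /greal_pi_eq h : greal_pi (BNet (cst_bounded_net (g i j))) =
  greal_pi (repr (greal_cst (g i j))) by rewrite greal_piK.
by move=> b; apply: filterS (h b) => e; rewrite !mxE.
Qed.

End GeneralizedNumbers.

(** * Representatives of generalized functions *)

Section ColombeauNets.
Variables (R : realType) (m : nat).
Local Notation I := (eps_index R).
Local Notation V := 'cV[R]_m.
Local Notation disc r := [set x : V | `|x| <= r].
Implicit Types (w : net R m) (K : set V).

Lemma compact_disc r : compact (disc r).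
Proof.
have -> : disc r = trmx @` [set y : 'rV[R]_m | `|y^T| <= r].
  apply/seteqP; split => [x xr|_ [y yr <-] //]; exists x^T; rewrite /= trmxK //.
have tr_cont n p : continuous (trmx : 'M[R]_(n, p) -> 'M[R]_(p, n)).
  by move=> x; apply: (@cvg_trmx _ _ (nbhs x) _ n p id).
apply: continuous_compact; first exact/continuous_subspaceT/tr_cont.
apply: bounded_closed_compact.
  exists r; split; first exact: num_real.
  move=> k rk y /= yr; apply: mx_norm_le => [|i j].
    by apply: ltW; apply: le_lt_trans rk; apply: le_trans yr.
  have -> : y i j = y^T j i by rewrite mxE.
  by apply: le_trans (mx_entry_le_norm _ _ _) _; apply: le_trans yr (ltW rk).
have cn : continuous (fun y : 'rV[R]_m => `|y^T|).
  move=> y; apply: (@continuous_comp _ _ _ trmx (@Num.norm R _)).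
    exact: tr_cont.
  exact: norm_continuous.
exact: (continuous_closedP _).1 cn _ (@closed_le R r).
Qed.

(** Every iterated partial derivative agrees, up to order, with a multi-index
    derivative. *)
Lemma multi_seq_count (s : seq 'I_m) :
  perm_eq (multi_seq [ffun i => count_mem i s]) s.
Proof.
apply/allP => i _ /=; rewrite /multi_seq count_flatten -map_comp sumnE big_map.
rewrite big_enum /= (bigD1 i) //= big1.
  by rewrite addn0 count_nseq /= eqxx mul1n ffunE.
by move=> j ji; rewrite count_nseq /= (negPf ji) mul0n.
Qed.

Lemma Re_le_normc (z : R[i]) : `|complex.Re z| <= complex.ComplexField.Normc.normc z.
Proof.
case: z => x y /=; rewrite -sqrtr_sqr ler_sqrt ?addr_ge0 ?sqr_ge0 //.
by rewrite lerDl sqr_ge0.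
Qed.

Lemma Im_le_normc (z : R[i]) : `|complex.Im z| <= complex.ComplexField.Normc.normc z.
Proof.
case: z => x y /=; rewrite -sqrtr_sqr ler_sqrt ?addr_ge0 ?sqr_ge0 //.
by rewrite lerDr sqr_ge0.
Qed.

(** Here and below, [part] is the real or the imaginary part, in terms of which
    complex derivatives are defined. *)
Lemma moderate_smooth w (part : R[i] -> R) :
  (part = @complex.Re R \/ part = @complex.Im R) ->
  moderate w -> smooth_moderate (fun e x => part (w e x)).
Proof.
move=> hpart [sw mw]; have spart e : smooth (fun x => part (w e x)).
  by have [sr si] := sw e; case: hpart => ->.
split=> // s r; pose alpha := [ffun i => count_mem i s].
have [b /bigO_powP[k k0 hk]] := mw (disc r) alpha (@compact_disc r).
exists (b - 1); near=> e => x xr.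
have h1 : `|seminorm (disc r) alpha (w e)| <= k * sval e `^ b by near: e.
have h2 : k * sval e `^ b <= sval e `^ (b - 1).
  by near: e; apply: near_absorb => //; rewrite gtrBl.
apply: le_trans h2; apply: le_trans h1; apply: le_trans (ler_norm _).
apply: le_trans (seminorm_ub alpha (sw e) (@compact_disc r) xr).
rewrite -(partials_perm (spart e) (multi_seq_count s)).
by case: hpart => ->; [exact: (Re_le_normc (cpartial_multi alpha (w e) x))|
  exact: (Im_le_normc (cpartial_multi alpha (w e) x))].
Unshelve. all: by end_near. Qed.

Lemma smooth_moderateB (u v : I -> V -> R) :
  smooth_moderate u -> smooth_moderate v -> smooth_moderate (fun e => u e - v e).
Proof.
move=> [su mu] [sv mv]; split=> [e|s r]; first exact: smoothB.
rewrite (_ : (fun e => _) = fun e x => partials s (u e) x + -1 * partials s (v e) x).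
  apply: mod_onD; [by []|exact: mu|apply: mod_onM => //].
  apply: (@mod_on_bounded _ _ _ _ _ _ _ 1) => //.
  by apply: nearW => e x _; rewrite normrN1.
by apply/funext => e; rewrite partialsB //; apply/funext => x; rewrite mulN1r.
Qed.

Lemma negligible_disc w (part : R[i] -> R) :
  (part = @complex.Re R \/ part = @complex.Im R) -> w \in @Defs.negligible R m ->
  forall r, negl_on (@eps0 R) (disc r) (fun e x => part (w e x)).
Proof.
move=> hpart /asboolP[sw nw] r b; pose alpha : {ffun 'I_m -> nat} := [ffun=> 0%N].
have [k k0 hk] := (bigO_powP _ _).1 (nw (disc r) alpha (@compact_disc r) (b + 1)).
have alpha0 : multi_seq alpha = [::].
  by rewrite /multi_seq; elim: (enum _) => //= i l ->; rewrite ffunE.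
near=> e => x xr.
have h1 : `|seminorm (disc r) alpha (w e)| <= k * sval e `^ (b + 1) by near: e.
have h2 : k * sval e `^ (b + 1) <= sval e `^ b.
  by near: e; apply: near_absorb => //; rewrite ltrDl.
apply: le_trans h2; apply: le_trans h1; apply: le_trans (ler_norm _).
apply: le_trans (seminorm_ub alpha (sw e) (@compact_disc r) xr).
rewrite /cpartial_multi /partial_multi alpha0.
by case: hpart => ->; [exact: (Re_le_normc (Complex _ _))|
  exact: (Im_le_normc (Complex _ _))].
Unshelve. all: by end_near. Qed.

Lemma disc_negligible w : (forall e, csmooth (w e)) ->
  (forall s r, negl_on (@eps0 R) (disc r)
     (fun e => partials s (fun x => complex.Re (w e x)))) ->
  (forall s r, negl_on (@eps0 R) (disc r)
     (fun e => partials s (fun x => complex.Im (w e x)))) ->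
  w \in @Defs.negligible R m.
Proof.
move=> sw nr ni; apply/asboolP; split => // K alpha cK b; apply/bigO_powP.
have [r rpos hr] : exists2 r : R, 0 < r & K `<=` disc r.
  by have [r r0 hr] := pinfty_ex_gt (num_real (0 : R)) (compact_bounded cK);
    exists r.
exists 2 => //; near=> e; rewrite ger0_norm ?seminorm_ge0 //.
have b0 : 0 <= 2 * sval e `^ b by rewrite mulr_ge0 ?powR_ge0.
have [->|/set0P[x0 Kx0]] := eqVneq K set0.
  by rewrite /seminorm image_set0 sup0.
apply: ge_sup; first by exists (complex.ComplexField.Normc.normc
  (cpartial_multi alpha (w e) x0)), x0.
move=> _ [x Kx <-]; apply: le_trans (normc_leD _) _.
have xr : disc r x by exact: hr.
rewrite mulr_natl mulr2n; apply: lerD.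
  by move: x xr {Kx}; near: e; exact: nr.
by move: x xr {Kx}; near: e; exact: ni.
Unshelve. all: by end_near. Qed.

Lemma colombeau_repr_moderate (f : net_quot R m) :
  colombeau R m f -> moderate (repr f).
Proof.
move=> [u [su mu] uf].
have : u - repr f \in @Defs.negligible R m.
  by rewrite Quotient.idealrBE reprK; apply/eqP.
move=> /asboolP[sn nn].
have E : (repr f : net R m) = u - (u - repr f) by rewrite subKr.
split=> [e|K alpha cK].
  have -> : repr f e = u e - (u - repr f) e by rewrite {1}E.
  exact: csmoothB.
have [b /bigO_powP[k k0 hk]] := mu K alpha cK.
have /bigO_powP[l l0 hl] := nn K alpha cK b.
exists b; apply/bigO_powP; exists (k + l); first exact: addr_gt0.
near=> e; rewrite ger0_norm ?seminorm_ge0 //.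
have -> : repr f e = u e - (u - repr f) e by rewrite {1}E.
apply: le_trans (seminormB alpha (su e) (sn e) cK) _; rewrite mulrDl.
by apply: lerD; apply: le_trans (ler_norm _) _; near: e.
Unshelve. all: by end_near. Qed.

End ColombeauNets.

(** The matrix chosen to represent the constant g in the composition is only
    negligibly close to g, which the substitution estimate repairs. *)
Lemma colombeau_part_invariance (R : realType) (d : nat) (f : net_quot R d.+1)
    (part : R[i] -> R) :
  (part = @complex.Re R \/ part = @complex.Im R) -> colombeau R d.+1 f ->
  (forall g : 'M[R]_d.+1, lorentz g ->
     colombeau_comp f (map_mx (@greal_cst R) g) = f) ->
  forall g : 'M[R]_d.+1, lorentz g -> forall r, negl_on (@eps0 R)
    [set x : 'cV[R]_d.+1 | `|x| <= r]
    (fun e x => part (repr f e (g *m x)) - part (repr f e x)).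
Proof.
move=> hpart cf hinv g lg r.
have mu := moderate_smooth hpart (colombeau_repr_moderate cf).
pose G e := greal_mx_eps (map_mx (@greal_cst R) g) e.
have [K hK] := greal_mx_eps_bounded (map_mx (@greal_cst R) g).
have n1 : negl_on (@eps0 R) [set x : 'cV[R]_d.+1 | `|x| <= r]
    (fun e x => part (repr f e (G e *m x)) - part (repr f e x)).
  have : (fun e x => repr f e (G e *m x)) - repr f \in @Defs.negligible R d.+1.
    by rewrite Quotient.idealrBE reprK; apply/eqP; exact: hinv.
  move=> /(negligible_disc hpart) /(_ r); apply: negl_on_near.
  by apply: nearW => e x _; case: hpart => ->; rewrite -raddfB.
have n2 : negl_on (@eps0 R) [set x : 'cV[R]_d.+1 | `|x| <= r]
    (fun e x => part (repr f e (g *m x)) - part (repr f e (G e *m x))).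
  apply: (@smooth_net_substitution _ _ (@eps0 R) _
    (fun e x => part (repr f e x)) (fun=> g) G (`|g| + `|K|) r) => //.
  - by apply: nearW => e; rewrite lerDl.
  - apply: filterS hK => e he; apply: le_trans he _.
    by apply: le_trans (ler_norm _) _; rewrite lerDr.
  - exact: greal_mx_eps_cst.
apply: negl_on_near (negl_onD _ n2 n1) => //.
by apply: nearW => e x _; rewrite subrKA.
Qed.

Theorem theorem6 (R : realType) (d : nat) (hd : (1 <= d)%N)
  (f : net_quot R d.+1) (hf : colombeau R d.+1 f)
  (hinv : forall g : 'M[R]_d.+1, lorentz g ->
     colombeau_comp f (map_mx (@greal_cst R) g) = f) :
  forall g : 'M[greal R]_d.+1, greal_lorentz g -> colombeau_comp f g = f.
Proof.
move=> g [isog detg posg].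
have mf := colombeau_repr_moderate hf.
pose A e := greal_mx_eps g e.
have [K hK] := greal_mx_eps_bounded g.
pose w : net R d.+1 := (fun e x => repr f e (A e *m x)) - repr f.
have main (part : R[i] -> R) :
    (part = @complex.Re R \/ part = @complex.Im R) ->
    (forall e, smooth (fun x => part (w e x))) /\
    forall s r, negl_on (@eps0 R) [set x : 'cV[R]_d.+1 | `|x| <= r]
      (fun e => partials s (fun x => part (w e x))).
  move=> hpart; have mu := moderate_smooth hpart mf.
  have mv := smooth_moderate_comp_linear mu hK.
  have E : (fun e x => part (w e x)) =
      (fun e => (fun x => part (repr f e (A e *m x))) - (fun x => part (repr f e x))).
    by apply/funext => e; case: hpart => ->; [exact: compl_ReB|exact: compl_ImB].
  have mw : smooth_moderate (fun e x => part (w e x)).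
    by rewrite E; exact: smooth_moderateB.
  split; first by case: mw.
  apply: negl_on_partials mw _; rewrite E.
  apply: (generalized_invariance mu _ hK).
  - exact: colombeau_part_invariance.
  - exact: greal_mx_eps_isometry.
  - exact: greal_mx_eps_det.
  - exact: greal_pos_eps.
have [sr nr] := main _ (or_introl erefl).
have [si ni] := main _ (or_intror erefl).
have : w \in @Defs.negligible R d.+1 by apply: disc_negligible.
by rewrite Quotient.idealrBE => /eqP; rewrite reprK.
Qed.
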